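(* Let $X\subseteq\omega$ be an oracle with $X\geq_T \emptyset'$. (a) There are equivalence relations $E_i$ ($i\in\omega$) on $\omega$ such that each $E_i$ is minimal, the $E_i$ are pairwise $\leq_c$-incomparable, and $E_i\in\Sigma^0_1(X)\setminus\Pi^0_1(X)$ for every $i$. (b) There are equivalence relations $F_i$ ($i\in\omega$) on $\omega$ such that each $F_i$ is minimal, the $F_i$ are pairwise $\leq_c$-incomparable, and $F_i\in\Pi^0_1(X)\setminus\Sigma^0_1(X)$ for every $i$. Furthermore, these can be chosen so that for every $i\in\omega$, every $E_i$-equivalence class and every $F_i$-equivalence class is computably enumerable.
   Context: All equivalence relations have domain $\omega$. For equivalence relations $R,S$, $R\leq_c S$ ($R$ is computably reducible to $S$) means there is a computable function $f$ with $xRy\Leftrightarrow f(x)Sf(y)$ for all $x,y$; $R\equiv_c S$ means $R\leq_c S$ and $S\leq_c R$. For $n\geq 1$, $\mathrm{Id}_n$ is the relation $x\,\mathrm{Id}_n\,y \Leftrightarrow n\mid (x-y)$. An equivalence relation $R$ is minimal if it has infinitely many classes and for every equivalence relation $E$, $E\leq_c R$ implies $E\equiv_c R$ or $E\equiv_c \mathrm{Id}_n$ for some $n$. $\Sigma^0_1(X)$ (resp. $\Pi^0_1(X)$) denotes the sets (here, sets of pairs) that are c.e. relative to $X$ (resp. co-c.e. relative to $X$). *)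

(* Defs.v *)
From Stdlib Require Import List Arith.
Import ListNotations.

Inductive code : Type :=
| czero
| csucc
| cproj (i : nat)
| coracle
| ccomp (f : code) (gs : list code)
| cprim (f g : code)
| cmu (f : code).

Inductive eval (X : nat -> bool) : code -> list nat -> nat -> Prop :=
| e_zero v : eval X czero v 0
| e_succ x v : eval X csucc (x :: v) (S x)
| e_proj i v : i < length v -> eval X (cproj i) v (nth i v 0)
| e_oracle x v : eval X coracle (x :: v) (if X x then 1 else 0)
| e_comp f gs v ws y :
    evals X gs v ws -> eval X f ws y -> eval X (ccomp f gs) v y
| e_prim0 f g v y : eval X f v y -> eval X (cprim f g) (0 :: v) y
| e_primS f g n v r y :
    eval X (cprim f g) (n :: v) r -> eval X g (n :: r :: v) y ->
    eval X (cprim f g) (S n :: v) y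
| e_mu f v n :
    eval X f (n :: v) 0 ->
    (forall m, m < n -> exists k, eval X f (m :: v) (S k)) ->
    eval X (cmu f) v n
with evals (X : nat -> bool) : list code -> list nat -> list nat -> Prop :=
| es_nil v : evals X nil v nil
| es_cons g gs v y ys :
    eval X g v y -> evals X gs v ys -> evals X (g :: gs) v (y :: ys).

Definition empty_oracle : nat -> bool := fun _ => false.

Definition cpair (a b : nat) : nat := (a + b) * (a + b + 1) / 2 + b.

Fixpoint enc (c : code) : nat :=
  match c with
  | czero => cpair 0 0
  | csucc => cpair 1 0
  | cproj i => cpair 2 i
  | coracle => cpair 3 0
  | ccomp f gs =>
      cpair 4 (cpair (enc f)
        ((fix encl (l : list code) : nat :=
            match l with
            | nil => 0
            | g :: l' => S (cpair (enc g) (encl l'))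
            end) gs))
  | cprim f g => cpair 5 (cpair (enc f) (enc g))
  | cmu f => cpair 6 (enc f)
  end.

Definition halting_set (e : nat) : Prop :=
  exists c y, enc c = e /\ eval empty_oracle c [e] y.

Definition turing_below (A : nat -> Prop) (X : nat -> bool) : Prop :=
  exists c, forall n, (A n -> eval X c [n] 1) /\ (~ A n -> eval X c [n] 0).

Definition computable (f : nat -> nat) : Prop :=
  exists c, forall x, eval empty_oracle c [x] (f x).

Definition is_equiv (R : nat -> nat -> Prop) : Prop :=
  (forall x, R x x) /\ (forall x y, R x y -> R y x) /\
  (forall x y z, R x y -> R y z -> R x z).

Definition creduc (R S : nat -> nat -> Prop) : Prop :=
  exists f, computable f /\ forall x y, R x y <-> S (f x) (f y).

Definition cequiv (R S : nat -> nat -> Prop) : Prop := creduc R S /\ creduc S R.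

Definition Id_ (n : nat) : nat -> nat -> Prop := fun x y => x mod n = y mod n.

Definition inf_classes (R : nat -> nat -> Prop) : Prop :=
  ~ exists l : list nat, forall x, exists y, In y l /\ R x y.

Definition minimal (R : nat -> nat -> Prop) : Prop :=
  inf_classes R /\
  forall E, is_equiv E -> creduc E R ->
    cequiv E R \/ exists n, 1 <= n /\ cequiv E (Id_ n).

Definition Sigma01 (X : nat -> bool) (R : nat -> nat -> Prop) : Prop :=
  exists c, forall x y, R x y <-> exists z, eval X c [x; y] z.

Definition Pi01 (X : nat -> bool) (R : nat -> nat -> Prop) : Prop :=
  Sigma01 X (fun x y => ~ R x y).

Definition ce_set (A : nat -> Prop) : Prop :=
  exists c, forall y, A y <-> exists z, eval empty_oracle c [y] z.

(* Main.v *)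
Require Import Defs.
From Stdlib Require Import List Arith Lia Classical ClassicalEpsilon.
Import ListNotations.

(* Let U be a dark ceer: a c.e. equivalence relation with infinitely many classes such that
   every computable function whose range meets infinitely many U-classes meets all of them.
   Number the U-classes by an X-computable index iota, which is possible since X computes
   0', and for a set C let R(C) merge the classes 2n and 2n+1 exactly when n is in C. Every
   R(C)-class is a union of at most two U-classes, hence c.e., and R(C) is minimal: a
   reduction f of E to R(C) is inverted by searching for z with f(z) U x if its range is
   infinite modulo U, and otherwise E has finitely many classes, all c.e., so E is
   equivalent to some Id_n. The relation R(C) is as complex as C relative to X.

   A reduction f of R(C) to R(C') decides n in C, X-effectively, from one membership
   question to C'. The natural numbers are cut into X-computable blocks growing fast enough
   for f to lead from block (i, f) to no later block, so these questions concern only the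
   part of C' below the block; the block has room for one position per possible value of
   that part, and the set C_i differs from the predicted answer at each of them. One further
   position per block diagonalizes C_i against the complements of the X-c.e. sets (for E_i)
   or against the X-c.e. sets (for F_i). *)

(** * Total recursive functions, decidable and Sigma_1 predicates relative to X *)

(* Functions of [n] variables are modelled on environments: lists of length [n]. *)
Definition tot (X : nat -> bool) (n : nat) (F : list nat -> nat) : Prop :=
  exists c, forall v, length v = n -> eval X c v (F v).

Lemma tot_ext X n F G :
  (forall v, length v = n -> F v = G v) -> tot X n F -> tot X n G.
Proof.
  intros H [c Hc]. exists c. intros v Hv. rewrite <- H by assumption. auto.
Qed.

Lemma tot_var X n i : i < n -> tot X n (fun v => nth i v 0).
Proof. intros H. exists (cproj i). intros v Hv. constructor. lia. Qed.

Lemma tot_comp X n m G (As : list (list nat -> nat)) :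
  tot X m G -> length As = m -> Forall (tot X n) As ->
  tot X n (fun v => G (map (fun A => A v) As)).
Proof.
  intros [c Hc] Hm HA.
  assert (exists cs, forall v, length v = n ->
            evals X cs v (map (fun A => A v) As)) as [cs Hcs].
  { clear Hm. induction HA as [|A As [a Ha] _ [cs Hcs]].
    - exists []. constructor.
    - exists (a :: cs). intros v Hv. constructor; auto. }
  exists (ccomp c cs). intros v Hv. econstructor; [eauto|].
  apply Hc. rewrite length_map. exact Hm.
Qed.

Lemma nth_seq_id (v : list nat) d :
  map (fun i => nth i v 0) (seq d (length v - d)) = skipn d v.
Proof.
  revert d. induction v as [|a v IH]; intros [|d]; simpl; auto.
  - f_equal. rewrite <- seq_shift, map_map.
    specialize (IH 0). rewrite Nat.sub_0_r in IH. exact IH.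
  - rewrite <- seq_shift, map_map. apply IH.
Qed.

(** The general change of environment: the first [d] variables give way to the values of [As], the
    others are passed on. *)
Lemma tot_subst X n m d F (As : list (list nat -> nat)) :
  tot X m F -> length As + (n - d) = m -> Forall (tot X n) As ->
  tot X n (fun v => F (map (fun A => A v) As ++ skipn d v)).
Proof.
  intros HF Hm HA.
  apply tot_ext with (fun v => F (map (fun A => A v)
    (As ++ map (fun i v => nth i v 0) (seq d (n - d))))).
  - intros v Hv. rewrite map_app, map_map, <- nth_seq_id, Hv. reflexivity.
  - apply tot_comp with m; auto.
    + rewrite length_app, length_map, length_seq. exact Hm.
    + apply Forall_app; split; auto. apply Forall_forall. intros G HG.
      apply in_map_iff in HG. destruct HG as [i [<- Hi]].
      apply in_seq in Hi. apply tot_var. lia.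
Qed.

Lemma tot_nth_tl X n i w :
  tot X n (fun v => nth (S i) (w v) 0) -> tot X n (fun v => nth i (tl (w v)) 0).
Proof.
  apply tot_ext. intros v _. destruct (w v); destruct i; reflexivity.
Qed.

Lemma tot_succ X n A : tot X n A -> tot X n (fun v => S (A v)).
Proof.
  intros [a Ha]. exists (ccomp csucc [a]). intros v Hv.
  econstructor; [|constructor]. constructor; [auto|constructor].
Qed.

Lemma tot_const X n k : tot X n (fun _ => k).
Proof.
  induction k as [|k IH].
  - exists czero. constructor.
  - apply (tot_succ X n (fun _ => k) IH).
Qed.

(** Bound, base and step may all depend on the parameters [v]. Written with [nat_rect], recursions
    are recognized syntactically by [tots]. *)
Lemma tot_rec X n A B (G : nat -> nat -> list nat -> nat) :
  tot X n A -> tot X n B ->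
  tot X (S (S n)) (fun w => G (nth 0 w 0) (nth 1 w 0) (tl (tl w))) ->
  tot X n (fun v => nat_rect (fun _ => nat) (B v) (fun k r => G k r v) (A v)).
Proof.
  intros HA [b Hb] [g Hg].
  assert (tot X (S n) (fun w =>
    nat_rect (fun _ => nat) (B (tl w)) (fun k r => G k r (tl w)) (nth 0 w 0))) as H.
  { exists (cprim b g). intros [|k v] Hv; [discriminate|].
    injection Hv as Hv. simpl. induction k as [|k IH]; simpl.
    - constructor. auto.
    - econstructor; [exact IH|].
      apply (Hg (k :: _ :: v)). simpl. congruence. }
  eapply tot_ext; [|apply (tot_subst X n (S n) 0 _ [A] H); simpl; auto; lia].
  reflexivity.
Qed.

Lemma least_zero (f : nat -> nat) k : f k = 0 ->
  exists k, f k = 0 /\ forall m, m < k -> exists j, f m = S j.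
Proof.
  induction k as [k IH] using lt_wf_ind. intros Hk.
  destruct (classic (exists m, m < k /\ f m = 0)) as [[m [Hm H]]|H].
  - eauto.
  - exists k. split; auto. intros m Hm. destruct (f m) eqn:E; [|eauto].
    exfalso. eauto.
Qed.

Lemma tot_search X n F :
  tot X (S n) F -> (forall v, length v = n -> exists k, F (k :: v) = 0) ->
  exists h, tot X n h /\ forall v, length v = n -> F (h v :: v) = 0.
Proof.
  intros [c Hc] Hex.
  set (Q v k := F (k :: v) = 0 /\ forall m, m < k -> exists j, F (m :: v) = S j).
  (* The length condition sits under the quantifier, so that choice yields a function on all
     lists. *)
  assert (forall v, exists k, length v = n -> Q v k) as H.
  { intros v. destruct (classic (length v = n)) as [Hv|Hv].
    - destruct (Hex v Hv) as [k Hk].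
      destruct (least_zero (fun k => F (k :: v)) k Hk) as [k' Hk']. exists k'. auto.
    - exists 0. tauto. }
  set (h v := proj1_sig (constructive_indefinite_description _ (H v))).
  assert (forall v, length v = n -> Q v (h v)) as Hh.
  { intros v. exact (proj2_sig (constructive_indefinite_description _ (H v))). }
  exists h. split.
  - exists (cmu c). intros v Hv. destruct (Hh v Hv) as [H0 H1]. constructor.
    + rewrite <- H0. apply Hc. simpl. congruence.
    + intros m Hm. destruct (H1 m Hm) as [j Hj]. exists j. rewrite <- Hj.
      apply Hc. simpl. congruence.
  - intros v Hv. apply Hh; auto.
Qed.

Definition tot1 X (f : nat -> nat) := tot X 1 (fun v => f (nth 0 v 0)).
Definition tot2 X (f : nat -> nat -> nat) :=
  tot X 2 (fun v => f (nth 0 v 0) (nth 1 v 0)).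
Definition tot3 X (f : nat -> nat -> nat -> nat) :=
  tot X 3 (fun v => f (nth 0 v 0) (nth 1 v 0) (nth 2 v 0)).

Lemma tot_comp1 X n f A : tot1 X f -> tot X n A -> tot X n (fun v => f (A v)).
Proof.
  intros Hf HA. apply (tot_comp X n 1 _ [A] Hf); auto.
Qed.

Lemma tot_comp2 X n f A B :
  tot2 X f -> tot X n A -> tot X n B -> tot X n (fun v => f (A v) (B v)).
Proof.
  intros Hf HA HB. apply (tot_comp X n 2 _ [A; B] Hf); auto.
Qed.

Lemma tot_comp3 X n f A B C :
  tot3 X f -> tot X n A -> tot X n B -> tot X n C ->
  tot X n (fun v => f (A v) (B v) (C v)).
Proof.
  intros Hf HA HB HC. apply (tot_comp X n 3 _ [A; B; C] Hf); auto.
Qed.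

Create HintDb tot.

(** Second-order patterns such as [@?A v] split an expression at its head symbol; the hint base
    [tot] supplies the functions already known to be computable. *)
Ltac tot_step :=
  match goal with
  | |- tot1 _ _ => solve [auto with tot nocore | eassumption]
  | |- tot2 _ _ => solve [auto with tot nocore | eassumption]
  | |- tot3 _ _ => solve [auto with tot nocore | eassumption]
  | |- tot ?X ?n (fun v => ?k) => apply (tot_const X n k)
  | |- tot _ _ (fun v => nth ?i v 0) => apply tot_var; lia
  | |- tot _ _ (fun v => nth ?i (tl (@?w v)) 0) => apply (tot_nth_tl _ _ i w)
  | |- tot _ _ (fun v => S (@?A v)) => apply (tot_succ _ _ A)
  | |- tot _ _ (fun v => nat_rect (fun _ => nat) (@?B v) (fun k r => @?G k r v) (@?A v)) =>
      apply (tot_rec _ _ A B G)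
  | |- tot _ _ (fun v => ?f (@?A v) (@?B v) (@?C v)) => apply (tot_comp3 _ _ f A B C)
  | |- tot _ _ (fun v => ?f (@?A v) (@?B v)) => apply (tot_comp2 _ _ f A B)
  | |- tot _ _ (fun v => ?f (@?A v)) => apply (tot_comp1 _ _ f A)
  end; cbv beta.

Ltac tots := repeat tot_step.

Lemma tot2_add X : tot2 X Nat.add.
Proof.
  eapply tot_ext with (fun v => nat_rect (fun _ => nat) (nth 1 v 0) (fun _ r => S r) (nth 0 v 0)).
  - intros v _. induction (nth 0 v 0); simpl; auto.
  - tots.
Qed.
#[export] Hint Resolve tot2_add : tot.

Lemma tot2_mul X : tot2 X Nat.mul.
Proof.
  eapply tot_ext with
    (fun v => nat_rect (fun _ => nat) 0 (fun _ r => nth 1 v 0 + r) (nth 0 v 0)).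
  - intros v _. induction (nth 0 v 0); simpl; auto.
  - tots.
Qed.
#[export] Hint Resolve tot2_mul : tot.

Lemma tot1_pred X : tot1 X Nat.pred.
Proof.
  eapply tot_ext with (fun v => nat_rect (fun _ => nat) 0 (fun k _ => k) (nth 0 v 0)).
  - intros v _. destruct (nth 0 v 0); reflexivity.
  - tots.
Qed.
#[export] Hint Resolve tot1_pred : tot.

Lemma tot2_sub X : tot2 X Nat.sub.
Proof.
  eapply tot_ext with
    (fun v => nat_rect (fun _ => nat) (nth 0 v 0) (fun _ r => Nat.pred r) (nth 1 v 0)).
  - intros v _. induction (nth 1 v 0) as [|k IH]; simpl; [lia|]. rewrite IH. lia.
  - tots.
Qed.
#[export] Hint Resolve tot2_sub : tot.

Definition ifz (c a b : nat) : nat := match c with 0 => a | S _ => b end.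

Lemma tot3_ifz X : tot3 X ifz.
Proof.
  eapply tot_ext with
    (fun v => nat_rect (fun _ => nat) (nth 1 v 0) (fun _ _ => nth 2 v 0) (nth 0 v 0)).
  - intros v _. destruct (nth 0 v 0); reflexivity.
  - tots.
Qed.
#[export] Hint Resolve tot3_ifz : tot.

(* [F] vanishes exactly where [P] holds. *)
Definition dec X n (P : list nat -> Prop) : Prop :=
  exists F, tot X n F /\ forall v, length v = n -> (P v <-> F v = 0).

Lemma dec_ext X n (P Q : list nat -> Prop) :
  (forall v, length v = n -> (P v <-> Q v)) -> dec X n P -> dec X n Q.
Proof.
  intros H [F [HF HP]]. exists F. split; auto. intros v Hv.
  rewrite <- H by assumption. auto.
Qed.

Lemma dec_eq X n A B : tot X n A -> tot X n B -> dec X n (fun v => A v = B v).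
Proof.
  intros HA HB. exists (fun v => (A v - B v) + (B v - A v)). split; [tots; auto|].
  intros v _. lia.
Qed.

Lemma dec_lt X n A B : tot X n A -> tot X n B -> dec X n (fun v => A v < B v).
Proof.
  intros HA HB. exists (fun v => S (A v) - B v). split; [tots; auto|].
  intros v _. lia.
Qed.

Lemma dec_le X n A B : tot X n A -> tot X n B -> dec X n (fun v => A v <= B v).
Proof.
  intros HA HB. exists (fun v => A v - B v). split; [tots; auto|].
  intros v _. lia.
Qed.

Lemma dec_and X n P Q : dec X n P -> dec X n Q -> dec X n (fun v => P v /\ Q v).
Proof.
  intros [F [HF HP]] [G [HG HQ]]. exists (fun v => F v + G v). split; [tots; auto|].
  intros v Hv. rewrite HP, HQ by assumption. lia.
Qed.

Lemma dec_or X n P Q : dec X n P -> dec X n Q -> dec X n (fun v => P v \/ Q v).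
Proof.
  intros [F [HF HP]] [G [HG HQ]]. exists (fun v => F v * G v). split; [tots; auto|].
  intros v Hv. rewrite HP, HQ by assumption. lia.
Qed.

Lemma dec_not X n P : dec X n P -> dec X n (fun v => ~ P v).
Proof.
  intros [F [HF HP]]. exists (fun v => 1 - F v). split; [tots; auto|].
  intros v Hv. rewrite HP by assumption. lia.
Qed.

(** The characteristic function is the product of those of the instances, which vanishes iff some
    factor does. *)
Lemma dec_bex X n B (P : list nat -> nat -> Prop) :
  tot X n B -> dec X (S n) (fun w => P (tl w) (nth 0 w 0)) ->
  dec X n (fun v => exists i, i < B v /\ P v i).
Proof.
  intros HB [F [HF HP]].
  exists (fun v => nat_rect (fun _ => nat) 1 (fun k r => F (k :: v) * r) (B v)).
  split.
  - apply (tot_rec X n B (fun _ => 1) (fun k r v => F (k :: v) * r)); tots; auto.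
    eapply tot_ext; [|apply (tot_subst X (S (S n)) (S n) 2 F [fun v => nth 0 v 0] HF)].
    + intros [|a [|b v]] _; reflexivity.
    + simpl; lia.
    + constructor; auto. apply tot_var. lia.
  - intros v Hv. induction (B v) as [|b IH]; simpl.
    + split; [intros [i [Hi _]]; lia|discriminate].
    + assert (P v b <-> F (b :: v) = 0) as Hb.
      { apply (HP (b :: v)). simpl. congruence. }
      split.
      * intros [i [Hi H]]. destruct (Nat.eq_dec i b) as [->|Hn].
        -- apply Hb in H. rewrite H. reflexivity.
        -- apply Nat.eq_mul_0. right. apply IH. exists i. split; auto. lia.
      * intros H. apply Nat.eq_mul_0 in H. destruct H as [H|H].
        -- exists b. split; auto. apply Hb. exact H.
        -- apply IH in H. destruct H as [i [Hi H]]. exists i. split; auto.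
Qed.

Lemma dec_ball X n B (P : list nat -> nat -> Prop) :
  tot X n B -> dec X (S n) (fun w => P (tl w) (nth 0 w 0)) ->
  dec X n (fun v => forall i, i < B v -> P v i).
Proof.
  intros HB HP. apply dec_ext with (fun v => ~ exists i, i < B v /\ ~ P v i).
  - intros v _. split.
    + intros H i Hi. apply NNPP. eauto.
    + intros H [i [Hi Hn]]. auto.
  - apply dec_not, dec_bex; auto. apply dec_not. exact HP.
Qed.

Definition dec1 X (P : nat -> Prop) := dec X 1 (fun v => P (nth 0 v 0)).
Definition dec2 X (P : nat -> nat -> Prop) :=
  dec X 2 (fun v => P (nth 0 v 0) (nth 1 v 0)).
Definition dec3 X (P : nat -> nat -> nat -> Prop) :=
  dec X 3 (fun v => P (nth 0 v 0) (nth 1 v 0) (nth 2 v 0)).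

Lemma dec_comp1 X n P A : dec1 X P -> tot X n A -> dec X n (fun v => P (A v)).
Proof.
  intros [F [HF HP]] HA. exists (fun v => F [A v]). split.
  - apply (tot_comp X n 1 F [A] HF); auto.
  - intros v Hv. apply (HP [A v]). reflexivity.
Qed.

Lemma dec_comp2 X n P A B :
  dec2 X P -> tot X n A -> tot X n B -> dec X n (fun v => P (A v) (B v)).
Proof.
  intros [F [HF HP]] HA HB. exists (fun v => F [A v; B v]). split.
  - apply (tot_comp X n 2 F [A; B] HF); auto.
  - intros v Hv. apply (HP [A v; B v]). reflexivity.
Qed.

Lemma dec_comp3 X n P A B C :
  dec3 X P -> tot X n A -> tot X n B -> tot X n C ->
  dec X n (fun v => P (A v) (B v) (C v)).
Proof.
  intros [F [HF HP]] HA HB HC. exists (fun v => F [A v; B v; C v]). split.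
  - apply (tot_comp X n 3 F [A; B; C] HF); auto.
  - intros v Hv. apply (HP [A v; B v; C v]). reflexivity.
Qed.

Ltac dec_step :=
  match goal with
  | |- dec1 _ _ => solve [auto with tot nocore | eassumption]
  | |- dec2 _ _ => solve [auto with tot nocore | eassumption]
  | |- dec3 _ _ => solve [auto with tot nocore | eassumption]
  | |- dec _ _ (fun v => ~ (@?P v)) => apply (dec_not _ _ P)
  | |- dec _ _ (fun v => @?P v /\ @?Q v) => apply (dec_and _ _ P Q)
  | |- dec _ _ (fun v => @?P v \/ @?Q v) => apply (dec_or _ _ P Q)
  | |- dec _ _ (fun v => exists i, i < @?B v /\ @?P v i) => apply (dec_bex _ _ B P)
  | |- dec _ _ (fun v => forall i, i < @?B v -> @?P v i) => apply (dec_ball _ _ B P)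
  | |- dec _ _ (fun v => @?A v = @?B v) => apply (dec_eq _ _ A B)
  | |- dec _ _ (fun v => @?A v < @?B v) => apply (dec_lt _ _ A B)
  | |- dec _ _ (fun v => @?A v <= @?B v) => apply (dec_le _ _ A B)
  | |- dec _ _ (fun v => ?P (@?A v) (@?B v) (@?C v)) => apply (dec_comp3 _ _ P A B C)
  | |- dec _ _ (fun v => ?P (@?A v) (@?B v)) => apply (dec_comp2 _ _ P A B)
  | |- dec _ _ (fun v => ?P (@?A v)) => apply (dec_comp1 _ _ P A)
  | _ => tot_step
  end; cbv beta.

Ltac decs := repeat dec_step.

(** The value is found by searching for it. This yields inverse operations, such as the projections
    of a pair, from the operations they invert. *)
Lemma tot_graph X n g :
  dec X (S n) (fun w => nth 0 w 0 = g (tl w)) -> tot X n g.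
Proof.
  intros [F [HF HP]]. destruct (tot_search X n F HF) as [h [Hh Hs]].
  - intros v Hv. exists (g v). apply (HP (g v :: v)); simpl; congruence.
  - apply tot_ext with h; auto. intros v Hv.
    apply (HP (h v :: v)); simpl; auto.
Qed.

(** This lets a definition branch on a decidable proposition through [excluded_middle_informative]
    and remain computable. *)
Lemma tot_if X n P A B :
  dec X n P -> tot X n A -> tot X n B ->
  tot X n (fun v => if excluded_middle_informative (P v) then A v else B v).
Proof.
  intros [F [HF HP]] HA HB. apply tot_ext with (fun v => ifz (F v) (A v) (B v)).
  - intros v Hv. specialize (HP v Hv).
    destruct (excluded_middle_informative (P v)) as [H|H].
    + apply HP in H. rewrite H. reflexivity.
    + destruct (F v); [tauto|reflexivity].
  - tots; auto.
Qed.

(** * Cantor pairing and codes of lists *)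

Fixpoint tri (n : nat) : nat := match n with 0 => 0 | S k => S k + tri k end.

(** Triangular numbers replace the division in [cpair], so that recursion and induction apply. *)
Lemma cpair_tri a b : cpair a b = tri (a + b) + b.
Proof.
  unfold cpair. f_equal.
  assert (H : forall n, n * (n + 1) = tri n * 2).
  { induction n as [|n IH]; simpl; auto. lia. }
  rewrite H. apply Nat.div_mul. lia.
Qed.

(** Walks along the antidiagonals: one step moves along the current one or, at its end, to the start
    of the next. *)
Fixpoint unpair (n : nat) : nat * nat :=
  match n with
  | 0 => (0, 0)
  | S k => match unpair k with (0, b) => (S b, 0) | (S a, b) => (a, S b) end
  end.

Definition pi1 n := fst (unpair n).
Definition pi2 n := snd (unpair n).

Lemma unpair_cpair a b : unpair (cpair a b) = (a, b).
Proof.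
  rewrite cpair_tri. remember (a + b) as s eqn:Hs.
  revert a b Hs. induction s as [|s IH]; intros a b Hs.
  - destruct a, b; try lia. reflexivity.
  - revert a Hs. induction b as [|b IHb]; intros a Hs.
    + rewrite Nat.add_0_r. simpl.
      replace (s + tri s) with (tri s + s) by lia.
      rewrite (IH 0 s) by lia. f_equal. lia.
    + rewrite Nat.add_succ_r. cbn [unpair].
      rewrite (IHb (S a)) by lia. reflexivity.
Qed.

Lemma cpair_pi n : cpair (pi1 n) (pi2 n) = n.
Proof.
  unfold pi1, pi2. induction n as [|n IH]; [reflexivity|].
  cbn [unpair]. destruct (unpair n) as [[|a] b]; cbn [fst snd] in *; rewrite cpair_tri in *.
  - replace (S b + 0) with (S b) by lia. simpl in *. lia.
  - replace (a + S b) with (S a + b) by lia. lia.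
Qed.

Lemma pi1_cpair a b : pi1 (cpair a b) = a.
Proof. unfold pi1. rewrite unpair_cpair. reflexivity. Qed.

Lemma pi2_cpair a b : pi2 (cpair a b) = b.
Proof. unfold pi2. rewrite unpair_cpair. reflexivity. Qed.

Lemma cpair_inj a b a' b' : cpair a b = cpair a' b' -> a = a' /\ b = b'.
Proof.
  intros H. apply (f_equal unpair) in H. rewrite !unpair_cpair in H.
  injection H. auto.
Qed.

Lemma tri_le n : n <= tri n.
Proof. induction n; simpl; lia. Qed.

Lemma tri_mono m n : m <= n -> tri m <= tri n.
Proof. induction 1; simpl; lia. Qed.

Lemma cpair_ge a b : a <= cpair a b /\ b <= cpair a b.
Proof. rewrite cpair_tri. pose proof (tri_le (a + b)). lia. Qed.

Lemma cpair_mono a b b' : b <= b' -> cpair a b <= cpair a b'.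
Proof.
  intros H. rewrite !cpair_tri. pose proof (tri_mono (a + b) (a + b')). lia.
Qed.

Lemma pi_le n : pi1 n <= n /\ pi2 n <= n.
Proof. rewrite <- (cpair_pi n) at 2 4. apply cpair_ge. Qed.

Lemma tot1_tri X : tot1 X tri.
Proof.
  eapply tot_ext with (fun v => nat_rect (fun _ => nat) 0 (fun k r => S k + r) (nth 0 v 0)).
  - intros v _. induction (nth 0 v 0); simpl; auto.
  - tots.
Qed.
#[export] Hint Resolve tot1_tri : tot.

Lemma tot2_cpair X : tot2 X cpair.
Proof.
  eapply tot_ext with (fun v => tri (nth 0 v 0 + nth 1 v 0) + nth 1 v 0).
  - intros v _. symmetry. apply cpair_tri.
  - tots.
Qed.
#[export] Hint Resolve tot2_cpair : tot.

Lemma tot1_pi1 X : tot1 X pi1.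
Proof.
  apply tot_graph. eapply dec_ext with
    (fun w => exists b, b < S (nth 1 w 0) /\ cpair (nth 0 w 0) b = nth 1 w 0).
  - intros [|a [|n [|]]] Hv; try discriminate. simpl. split.
    + intros [b [_ <-]]. rewrite pi1_cpair. reflexivity.
    + intros ->. exists (pi2 n). rewrite cpair_pi. destruct (pi_le n). lia.
  - decs.
Qed.
#[export] Hint Resolve tot1_pi1 : tot.

Lemma tot1_pi2 X : tot1 X pi2.
Proof.
  apply tot_graph. eapply dec_ext with
    (fun w => exists b, b < S (nth 1 w 0) /\ cpair b (nth 0 w 0) = nth 1 w 0).
  - intros [|a [|n [|]]] Hv; try discriminate. simpl. split.
    + intros [b [_ <-]]. rewrite pi2_cpair. reflexivity.
    + intros ->. exists (pi1 n). rewrite cpair_pi. destruct (pi_le n). lia.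
  - decs.
Qed.
#[export] Hint Resolve tot1_pi2 : tot.

(* The same coding of lists as the one inside [enc]. *)
Fixpoint cl (l : list nat) : nat :=
  match l with [] => 0 | a :: l' => S (cpair a (cl l')) end.

(** The tail [pi2 k] is not a structural subterm of [S k], whence the fuel; it is at most [k], so
    [n] itself is enough fuel. *)
Fixpoint dlf (fuel n : nat) : list nat :=
  match fuel, n with
  | S f, S k => pi1 k :: dlf f (pi2 k)
  | _, _ => []
  end.

Definition dl n := dlf n n.

Lemma cl_dl n : cl (dl n) = n.
Proof.
  unfold dl. assert (forall f n, n <= f -> cl (dlf f n) = n) as H; [|auto].
  induction f as [|f IH]; intros [|k] Hk; simpl; auto; try lia.
  rewrite IH, cpair_pi; auto. destruct (pi_le k). lia.
Qed.

Lemma cl_inj l l' : cl l = cl l' -> l = l'.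
Proof.
  revert l'. induction l as [|a l IH]; intros [|a' l'] H; simpl in H; try discriminate; auto.
  injection H as H. apply cpair_inj in H as [-> H]. f_equal. auto.
Qed.

Lemma dl_cl l : dl (cl l) = l.
Proof. apply cl_inj, cl_dl. Qed.

Lemma cl_length l : length l <= cl l.
Proof.
  induction l as [|a l IH]; simpl; auto. destruct (cpair_ge a (cl l)). lia.
Qed.

Lemma cl_In x l : In x l -> x < cl l.
Proof.
  induction l as [|a l IH]; simpl; [tauto|]. destruct (cpair_ge a (cl l)).
  intros [->|H']; [lia|]. apply IH in H'. lia.
Qed.

Definition chd L := pi1 (pred L).
Definition ctl L := pi2 (pred L).
Definition ccons a L := S (cpair a L).
Definition cdrop i L := nat_rect (fun _ => nat) L (fun _ r => ctl r) i.

Lemma tot1_chd X : tot1 X chd.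
Proof. unfold tot1, chd. tots. Qed.
Lemma tot1_ctl X : tot1 X ctl.
Proof. unfold tot1, ctl. tots. Qed.
Lemma tot2_ccons X : tot2 X ccons.
Proof. unfold tot2, ccons. tots. Qed.
#[export] Hint Resolve tot1_chd tot1_ctl tot2_ccons : tot.
Lemma tot2_cdrop X : tot2 X cdrop.
Proof. unfold tot2, cdrop. tots. Qed.
#[export] Hint Resolve tot2_cdrop : tot.

Lemma chd_cl l : chd (cl l) = nth 0 l 0.
Proof. destruct l; unfold chd; simpl; [reflexivity|apply pi1_cpair]. Qed.

Lemma ctl_cl l : ctl (cl l) = cl (tl l).
Proof. destruct l; unfold ctl; simpl; [reflexivity|apply pi2_cpair]. Qed.

Lemma cdrop_cl i l : cdrop i (cl l) = cl (skipn i l).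
Proof.
  revert l. induction i as [|i IH]; intros l; [reflexivity|].
  unfold cdrop in *. simpl nat_rect. rewrite IH, ctl_cl. f_equal.
  clear. revert l. induction i as [|i IH]; intros [|a l]; simpl; auto.
Qed.

(** A right fold whose step also sees the code of the tail, which the validity of a derivation
    refers to. *)
Fixpoint lrec (b : nat) (g : nat -> nat -> nat -> nat) (l : list nat) : nat :=
  match l with [] => b | a :: l' => g a (cl l') (lrec b g l') end.

Lemma skipn_cons {T} i (l : list T) : i < length l ->
  exists a, skipn i l = a :: skipn (S i) l.
Proof.
  revert l. induction i as [|i IH]; intros [|a l] H; simpl in *; try lia; eauto.
  apply IH. lia.
Qed.

(** The fold becomes a primitive recursion on [j] up to the code of the list, which bounds its
    length. Round [j] prepends to the suffix treated so far the entry at distance [S j] from the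
    code; [ifz] skips the rounds in which the suffix is still empty. *)
Lemma tot_lrec X n A B (G : nat -> nat -> nat -> list nat -> nat) :
  tot X n A -> tot X n B ->
  tot X (S (S (S n))) (fun w =>
    G (nth 0 w 0) (nth 1 w 0) (nth 2 w 0) (tl (tl (tl w)))) ->
  tot X n (fun v => lrec (B v) (fun a t r => G a t r v) (dl (A v))).
Proof.
  intros HA HB HG.
  apply tot_ext with (fun v => nat_rect (fun _ => nat) (B v)
    (fun j r => ifz (cdrop (A v - S j) (A v)) r
       (G (chd (cdrop (A v - S j) (A v))) (ctl (cdrop (A v - S j) (A v))) r v)) (A v)).
  - intros v _. remember (dl (A v)) as l eqn:Hl.
    assert (A v = cl l) as E by (rewrite Hl, cl_dl; reflexivity).
    rewrite E. clear Hl E.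
    set (R := nat_rect (fun _ => nat) (B v) _).
    assert (forall j, j <= cl l ->
      R j = lrec (B v) (fun a t r => G a t r v) (skipn (cl l - j) l)) as H.
    { induction j as [|j IH]; intros Hj.
      - rewrite Nat.sub_0_r, skipn_all2; [reflexivity|apply cl_length].
      - unfold R in *. simpl nat_rect. rewrite cdrop_cl, IH by lia.
        destruct (le_lt_dec (length l) (cl l - S j)) as [Hk|Hk].
        + rewrite !skipn_all2 by lia. reflexivity.
        + destruct (skipn_cons _ _ Hk) as [a Ha].
          replace (S (cl l - S j)) with (cl l - j) in Ha by lia.
          rewrite Ha. unfold chd, ctl. simpl. rewrite pi1_cpair, pi2_cpair. reflexivity. }
    rewrite H, Nat.sub_diag; auto.
  - assert (Hw : forall H, tot X n H -> tot X (S (S n)) (fun w => H (tl (tl w)))).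
    { intros H HH. eapply tot_ext; [|apply (tot_subst X (S (S n)) n 2 H [] HH)]; simpl; auto; try lia.
      intros [|? [|? ?]] _; reflexivity. }
    tots; auto.
    eapply tot_ext; [|apply (tot_subst X (S (S n)) (S (S (S n))) 2 _
      [fun w => chd (cdrop (A (tl (tl w)) - S (nth 0 w 0)) (A (tl (tl w))));
       fun w => ctl (cdrop (A (tl (tl w)) - S (nth 0 w 0)) (A (tl (tl w))));
       fun w => nth 1 w 0] HG)].
    + intros [|? [|? ?]] _; reflexivity.
    + simpl. lia.
    + repeat constructor; tots; auto.
Qed.

Definition lenc L := length (dl L).
Definition nthc i L := nth i (dl L) 0.
Definition mem z L := In z (dl L).

Lemma tot1_lenc X : tot1 X lenc.
Proof.
  eapply tot_ext with (fun v => lrec 0 (fun _ _ r => S r) (dl (nth 0 v 0))).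
  - intros v _. unfold lenc. induction (dl (nth 0 v 0)); simpl; auto.
  - apply tot_lrec with (G := fun _ _ r _ => S r); tots.
Qed.
#[export] Hint Resolve tot1_lenc : tot.

Lemma nthc_cdrop i L : nthc i L = chd (cdrop i L).
Proof.
  unfold nthc. rewrite <- (cl_dl L) at 2. rewrite cdrop_cl, chd_cl.
  rewrite nth_skipn, Nat.add_0_r. reflexivity.
Qed.

Lemma tot2_nthc X : tot2 X nthc.
Proof.
  eapply tot_ext with (fun v => chd (cdrop (nth 0 v 0) (nth 1 v 0))).
  - intros v _. symmetry. apply nthc_cdrop.
  - tots.
Qed.
#[export] Hint Resolve tot2_nthc : tot.

Lemma dec2_mem X : dec2 X mem.
Proof.
  apply dec_ext with (fun v =>
    exists i, i < lenc (nth 1 v 0) /\ nthc i (nth 1 v 0) = nth 0 v 0).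
  - intros v _. unfold mem, lenc, nthc. split.
    + intros [i [Hi <-]]. apply nth_In. exact Hi.
    + intros H. destruct (In_nth _ _ 0 H) as [i Hi]. eauto.
  - decs.
Qed.
#[export] Hint Resolve dec2_mem : tot.

(** * Relatively c.e. predicates and their computable selectors *)

Definition sig X n (P : list nat -> Prop) : Prop :=
  exists F, tot X (S n) F /\
    forall v, length v = n -> (P v <-> exists w, F (w :: v) = 0).

Definition sig1 X (P : nat -> Prop) := sig X 1 (fun v => P (nth 0 v 0)).
Definition sig2 X (P : nat -> nat -> Prop) :=
  sig X 2 (fun v => P (nth 0 v 0) (nth 1 v 0)).
Definition sig3 X (P : nat -> nat -> nat -> Prop) :=
  sig X 3 (fun v => P (nth 0 v 0) (nth 1 v 0) (nth 2 v 0)).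

Lemma sig_ext X n (P Q : list nat -> Prop) :
  (forall v, length v = n -> (P v <-> Q v)) -> sig X n P -> sig X n Q.
Proof.
  intros H [F [HF HP]]. exists F. split; auto. intros v Hv.
  rewrite <- H by assumption. auto.
Qed.

Lemma tot_tl X n F : tot X n F -> tot X (S n) (fun w => F (tl w)).
Proof.
  intros H. eapply tot_ext; [|apply (tot_subst X (S n) n 1 F [] H)]; simpl; auto; lia.
Qed.

Lemma tot_cons_hd X n F A :
  tot X (S n) F -> tot X (S n) A -> tot X (S n) (fun w => F (A w :: tl w)).
Proof.
  intros H HA. eapply tot_ext; [|apply (tot_subst X (S n) (S n) 1 F [A] H)];
    simpl; auto; lia.
Qed.

Lemma sig_dec X n P : dec X n P -> sig X n P.
Proof.
  intros [F [HF HP]]. exists (fun w => F (tl w)). split; [apply tot_tl; auto|].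
  intros v Hv. rewrite HP by assumption. simpl. firstorder.
Qed.

Lemma sig_or X n P Q : sig X n P -> sig X n Q -> sig X n (fun v => P v \/ Q v).
Proof.
  intros [F [HF HP]] [G [HG HQ]]. exists (fun w => F w * G w). split; [tots; auto|].
  intros v Hv. rewrite HP, HQ by assumption. split.
  - intros [[w H]|[w H]]; exists w; rewrite H; lia.
  - intros [w H]. apply Nat.eq_mul_0 in H. destruct H; eauto.
Qed.

Lemma sig_and X n P Q : sig X n P -> sig X n Q -> sig X n (fun v => P v /\ Q v).
Proof.
  intros [F [HF HP]] [G [HG HQ]].
  exists (fun w => F (pi1 (nth 0 w 0) :: tl w) + G (pi2 (nth 0 w 0) :: tl w)). split.
  - tots; apply tot_cons_hd; auto; tots.
  - intros v Hv. rewrite HP, HQ by assumption. simpl. split.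
    + intros [[w H] [w' H']]. exists (cpair w w').
      rewrite pi1_cpair, pi2_cpair. lia.
    + intros [w H]. split; [exists (pi1 w)|exists (pi2 w)]; lia.
Qed.

Lemma sig_ex X n (P : list nat -> nat -> Prop) :
  sig X (S n) (fun w => P (tl w) (nth 0 w 0)) -> sig X n (fun v => exists k, P v k).
Proof.
  intros [F [HF HP]].
  exists (fun w => F (pi2 (nth 0 w 0) :: pi1 (nth 0 w 0) :: tl w)). split.
  - eapply tot_ext; [|apply (tot_subst X (S n) (S (S n)) 1 F
      [fun w => pi2 (nth 0 w 0); fun w => pi1 (nth 0 w 0)] HF)]; simpl; auto; try lia.
    repeat constructor; tots.
  - intros v Hv. simpl. split.
    + intros [k Hk]. apply (HP (k :: v)) in Hk; [|simpl; congruence].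
      destruct Hk as [w Hw]. exists (cpair k w). rewrite pi1_cpair, pi2_cpair. exact Hw.
    + intros [w Hw]. exists (pi1 w). apply (HP (pi1 w :: v)); [simpl; congruence|].
      eauto.
Qed.

Lemma sig_comp X n m P (As : list (list nat -> nat)) :
  sig X m P -> length As = m -> Forall (tot X n) As ->
  sig X n (fun v => P (map (fun A => A v) As)).
Proof.
  intros [F [HF HP]] Hm HA.
  exists (fun w => F (nth 0 w 0 :: map (fun A => A (tl w)) As)). split.
  - apply tot_ext with (fun w => F (map (fun A => A w)
      ((fun w => nth 0 w 0) :: map (fun A w => A (tl w)) As))).
    { intros w _. simpl. rewrite map_map. reflexivity. }
    apply tot_comp with (S m); auto.
    + simpl. rewrite length_map. congruence.
    + constructor; [tots|]. apply Forall_forall. intros G HG.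
      apply in_map_iff in HG. destruct HG as [A [<- Hi]].
      rewrite Forall_forall in HA. apply tot_tl. auto.
  - intros v Hv. apply (HP (map (fun A => A v) As)). rewrite length_map. exact Hm.
Qed.

Lemma sig_comp1 X n P A : sig1 X P -> tot X n A -> sig X n (fun v => P (A v)).
Proof. intros H HA. apply (sig_comp X n 1 _ [A] H); auto. Qed.

Lemma sig_comp2 X n P A B :
  sig2 X P -> tot X n A -> tot X n B -> sig X n (fun v => P (A v) (B v)).
Proof. intros H HA HB. apply (sig_comp X n 2 _ [A; B] H); auto. Qed.

Lemma sig_comp3 X n P A B C :
  sig3 X P -> tot X n A -> tot X n B -> tot X n C ->
  sig X n (fun v => P (A v) (B v) (C v)).
Proof. intros H HA HB HC. apply (sig_comp X n 3 _ [A; B; C] H); auto. Qed.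

(** Decidability is tried first, so that bounded quantifiers are not treated as unbounded ones. *)
Ltac sig_step :=
  match goal with
  | |- sig1 _ _ => solve [auto with tot nocore | eassumption]
  | |- sig2 _ _ => solve [auto with tot nocore | eassumption]
  | |- sig3 _ _ => solve [auto with tot nocore | eassumption]
  | |- sig _ _ _ => apply sig_dec; solve [decs]
  | |- sig _ _ (fun v => @?P v /\ @?Q v) => apply (sig_and _ _ P Q)
  | |- sig _ _ (fun v => @?P v \/ @?Q v) => apply (sig_or _ _ P Q)
  | |- sig _ _ (fun v => exists i, @?P v i) => apply (sig_ex _ _ P)
  | |- sig _ _ (fun v => ?P (@?A v) (@?B v) (@?C v)) => apply (sig_comp3 _ _ P A B C)
  | |- sig _ _ (fun v => ?P (@?A v) (@?B v)) => apply (sig_comp2 _ _ P A B)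
  | |- sig _ _ (fun v => ?P (@?A v)) => apply (sig_comp1 _ _ P A)
  | _ => tot_step
  end; cbv beta.

Ltac sigs := repeat sig_step.

(** Uniformization: a value and a witness for it are searched for together, as one pair, and the
    value is kept. *)
Lemma sig_select X n (P : list nat -> nat -> Prop) :
  sig X (S n) (fun w => P (tl w) (nth 0 w 0)) ->
  (forall v, length v = n -> exists k, P v k) ->
  exists h, tot X n h /\ forall v, length v = n -> P v (h v).
Proof.
  intros [F [HF HP]] Hex.
  set (F' := fun w => F (pi2 (nth 0 w 0) :: pi1 (nth 0 w 0) :: tl w)).
  destruct (tot_search X n F') as [h [Hh Hs]].
  - eapply tot_ext; [|apply (tot_subst X (S n) (S (S n)) 1 F
      [fun w => pi2 (nth 0 w 0); fun w => pi1 (nth 0 w 0)] HF)]; simpl; auto; try lia.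
    repeat constructor; tots.
  - intros v Hv. destruct (Hex v Hv) as [k Hk].
    apply (HP (k :: v)) in Hk; [|simpl; congruence]. destruct Hk as [w Hw].
    exists (cpair k w). unfold F'. simpl. rewrite pi1_cpair, pi2_cpair. exact Hw.
  - exists (fun v => pi1 (h v)). split; [tots; auto|]. intros v Hv.
    apply (HP (pi1 (h v) :: v)); [simpl; congruence|].
    specialize (Hs v Hv). unfold F' in Hs. simpl in Hs. eauto.
Qed.

Lemma sig_select1 X (P : nat -> nat -> Prop) :
  sig2 X P -> (forall x, exists k, P x k) ->
  exists h, tot1 X h /\ forall x, P x (h x).
Proof.
  intros HP Hex.
  destruct (sig_select X 1 (fun v k => P (nth 0 v 0) k)) as [h [Hh Hs]].
  - sigs.
  - eauto.
  - exists (fun x => h [x]). split.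
    + apply (tot_comp X 1 1 h [fun v => nth 0 v 0] Hh); auto. constructor; auto. tots.
    + intros x. apply (Hs [x]). reflexivity.
Qed.

(** * The Kleene normal form *)

(* The automatic scheme gives no hypothesis for the evaluations under the [exists] of
   [e_mu]. *)
Section EvalInd.
  Variables (X : nat -> bool) (P : code -> list nat -> nat -> Prop)
    (Q : list code -> list nat -> list nat -> Prop).
  Hypothesis Hzero : forall v, P czero v 0.
  Hypothesis Hsucc : forall x v, P csucc (x :: v) (S x).
  Hypothesis Hproj : forall i v, i < length v -> P (cproj i) v (nth i v 0).
  Hypothesis Horacle : forall x v, P coracle (x :: v) (if X x then 1 else 0).
  Hypothesis Hcomp : forall f gs v ws y,
    Q gs v ws -> P f ws y -> P (ccomp f gs) v y.
  Hypothesis Hprim0 : forall f g v y, P f v y -> P (cprim f g) (0 :: v) y.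
  Hypothesis HprimS : forall f g n v r y,
    P (cprim f g) (n :: v) r -> P g (n :: r :: v) y -> P (cprim f g) (S n :: v) y.
  Hypothesis Hmu : forall f v n, P f (n :: v) 0 ->
    (forall m, m < n -> exists k, P f (m :: v) (S k)) -> P (cmu f) v n.
  Hypothesis Hnil : forall v, Q [] v [].
  Hypothesis Hcons : forall g gs v y ys,
    P g v y -> Q gs v ys -> Q (g :: gs) v (y :: ys).

  Fixpoint eval_nested_ind c v y (H : eval X c v y) {struct H} : P c v y :=
    match H with
    | e_zero _ v => Hzero v
    | e_succ _ x v => Hsucc x v
    | e_proj _ i v Hi => Hproj i v Hi
    | e_oracle _ x v => Horacle x v
    | e_comp _ f gs v ws y H1 H2 =>
        Hcomp f gs v ws y (evals_nested_ind gs v ws H1) (eval_nested_ind f ws y H2)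
    | e_prim0 _ f g v y H1 => Hprim0 f g v y (eval_nested_ind f v y H1)
    | e_primS _ f g n v r y H1 H2 =>
        HprimS f g n v r y (eval_nested_ind _ _ _ H1) (eval_nested_ind _ _ _ H2)
    | e_mu _ f v n H1 H2 =>
        Hmu f v n (eval_nested_ind _ _ _ H1)
          (fun m hm => match H2 m hm with
             ex_intro _ k hk => ex_intro _ k (eval_nested_ind _ _ _ hk) end)
    end
  with evals_nested_ind gs v ws (H : evals X gs v ws) {struct H} : Q gs v ws :=
    match H with
    | es_nil _ v => Hnil v
    | es_cons _ g gs v y ys H1 H2 =>
        Hcons g gs v y ys (eval_nested_ind _ _ _ H1) (evals_nested_ind _ _ _ H2)
    end.
End EvalInd.

Lemma eval_det X c v y : eval X c v y -> forall y', eval X c v y' -> y = y'.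
Proof.
  revert c v y.
  apply (eval_nested_ind X (fun c v y => forall y', eval X c v y' -> y = y')
    (fun gs v ws => forall ws', evals X gs v ws' -> ws = ws')).
  - intros v y' H. inversion H; auto.
  - intros x v y' H. inversion H; auto.
  - intros i v Hi y' H. inversion H; auto.
  - intros x v y' H. inversion H; auto.
  - intros f gs v ws y IH1 IH2 y' H. inversion H; subst.
    apply IH2. rewrite (IH1 ws0); auto.
  - intros f g v y IH y' H. inversion H; subst. auto.
  - intros f g n v r y IH1 IH2 y' H. inversion H; subst.
    apply IH2. rewrite (IH1 r0); auto.
  - intros f v n IH1 IH2 y' H. inversion H as [| | | | | | |f' v' n' Ha Hb]; subst.
    (* If two results of a search differed, the function would be both zero and positive at the
       smaller one. *)
    destruct (lt_eq_lt_dec n y') as [[Hl|He]|Hl]; auto.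
    + destruct (Hb n Hl) as [k Hk]. discriminate (IH1 _ Hk).
    + destruct (IH2 y' Hl) as [k Hk]. discriminate (Hk _ Ha).
  - intros v ws' H. inversion H; auto.
  - intros g gs v y ys IH1 IH2 ws' H. inversion H; subst. f_equal; auto.
Qed.

(** The program searches for the least witness. The positive values below it that [e_mu] demands
    exist because [F] is total. *)
Lemma sig_code X n P : sig X n P ->
  exists c, forall v, length v = n -> (P v <-> exists z, eval X c v z).
Proof.
  intros [F [[c Hc] HP]]. exists (cmu c). intros v Hv. rewrite HP by assumption. split.
  - intros [w Hw]. destruct (least_zero (fun k => F (k :: v)) w Hw) as [k [H0 H1]].
    exists k. constructor.
    + rewrite <- H0. apply Hc. simpl. congruence.
    + intros m Hm. destruct (H1 m Hm) as [j Hj]. exists j. rewrite <- Hj.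
      apply Hc. simpl. congruence.
  - intros [z Hz]. exists z. inversion Hz; subst.
    eapply eval_det; [|eassumption]. apply Hc. reflexivity.
Qed.

(* An evaluation is certified by a finite list of judgements, each an instance of an
   evaluation rule whose premises occur later in the list; validity is decidable, so
   evaluation is Sigma_1. The judgement [J (enc c) (cl v) y] stands for [eval X c v y]. *)
Definition J (e v y : nat) := cpair e (cpair v y).
Definition je x := pi1 x.
Definition jv x := pi1 (pi2 x).
Definition jy x := pi2 (pi2 x).

Lemma je_J e v y : je (J e v y) = e.
Proof. apply pi1_cpair. Qed.
Lemma jv_J e v y : jv (J e v y) = v.
Proof. unfold jv, J. rewrite pi2_cpair. apply pi1_cpair. Qed.
Lemma jy_J e v y : jy (J e v y) = y.
Proof. unfold jy, J. rewrite pi2_cpair. apply pi2_cpair. Qed.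

Lemma J_ge e v y : v <= J e v y /\ y <= J e v y.
Proof.
  unfold J. destruct (cpair_ge v y), (cpair_ge e (cpair v y)). lia.
Qed.

Lemma tot3_J X : tot3 X J.
Proof. unfold tot3, J. tots. Qed.
Lemma tot1_je X : tot1 X je.
Proof. unfold tot1, je. tots. Qed.
Lemma tot1_jv X : tot1 X jv.
Proof. unfold tot1, jv. tots. Qed.
Lemma tot1_jy X : tot1 X jy.
Proof. unfold tot1, jy. tots. Qed.
#[export] Hint Resolve tot3_J tot1_je tot1_jv tot1_jy : tot.

Definition oraclef (X : nat -> bool) x := if X x then 1 else 0.
Lemma tot1_oracle X : tot1 X (oraclef X).
Proof.
  exists coracle. intros [|x [|]] Hv; try discriminate. apply e_oracle.
Qed.
#[export] Hint Resolve tot1_oracle : tot.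

Fixpoint encl (l : list code) : nat :=
  match l with [] => 0 | g :: l' => S (cpair (enc g) (encl l')) end.

Lemma enc_comp f gs : enc (ccomp f gs) = cpair 4 (cpair (enc f) (encl gs)).
Proof. reflexivity. Qed.

(* The tag 7, unused by [enc], marks judgements for [evals]. *)
Definition just X (x L : nat) : Prop :=
  (je x = cpair 0 0 /\ jy x = 0) \/
  (je x = cpair 1 0 /\ 0 < lenc (jv x) /\ jy x = S (nthc 0 (jv x))) \/
  (pi1 (je x) = 2 /\ pi2 (je x) < lenc (jv x) /\ jy x = nthc (pi2 (je x)) (jv x)) \/
  (je x = cpair 3 0 /\ 0 < lenc (jv x) /\ jy x = oraclef X (nthc 0 (jv x))) \/
  (pi1 (je x) = 4 /\ exists ws, ws < L /\
     (mem (J (cpair 7 (pi2 (pi2 (je x)))) (jv x) ws) L /\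
      mem (J (pi1 (pi2 (je x))) ws (jy x)) L)) \/
  (pi1 (je x) = 5 /\ 0 < lenc (jv x) /\ nthc 0 (jv x) = 0 /\
     mem (J (pi1 (pi2 (je x))) (ctl (jv x)) (jy x)) L) \/
  (pi1 (je x) = 5 /\ 0 < lenc (jv x) /\ 0 < nthc 0 (jv x) /\
     exists r, r < L /\
     (mem (J (je x) (ccons (pred (nthc 0 (jv x))) (ctl (jv x))) r) L /\
      mem (J (pi2 (pi2 (je x)))
        (ccons (pred (nthc 0 (jv x))) (ccons r (ctl (jv x)))) (jy x)) L)) \/
  (pi1 (je x) = 6 /\ mem (J (pi2 (je x)) (ccons (jy x) (jv x)) 0) L /\
     forall m, m < jy x -> exists k, k < L /\
       mem (J (pi2 (je x)) (ccons m (jv x)) (S k)) L) \/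
  (pi1 (je x) = 7 /\ pi2 (je x) = 0 /\ jy x = 0) \/
  (pi1 (je x) = 7 /\ 0 < pi2 (je x) /\ 0 < jy x /\
     mem (J (chd (pi2 (je x))) (jv x) (chd (jy x))) L /\
     mem (J (cpair 7 (ctl (pi2 (je x)))) (jv x) (ctl (jy x))) L).

Lemma dec2_just X : dec2 X (just X).
Proof. unfold dec2, just. decs. Qed.
#[export] Hint Resolve dec2_just : tot.

Fixpoint valid X (l : list nat) : Prop :=
  match l with [] => True | x :: l' => just X x (cl l') /\ valid X l' end.

(** The characteristic function of validity is the sum, over all entries, of that of [just]. *)
Lemma dec1_valid X : dec1 X (fun L => valid X (dl L)).
Proof.
  destruct (dec2_just X) as [F [HF HP]].
  exists (fun v => lrec 0 (fun a t r => F [a; t] + r) (dl (nth 0 v 0))). split.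
  - apply (tot_lrec X 1 _ _ (fun a t r _ => F [a; t] + r)); tots.
    eapply tot_ext; [|apply (tot_comp X 4 2 F [fun w => nth 0 w 0; fun w => nth 1 w 0] HF)];
      auto.
    repeat constructor; tots.
  - intros v _. induction (dl (nth 0 v 0)) as [|x l IH]; simpl; [tauto|].
    rewrite IH, (HP [x; cl l] eq_refl). simpl. lia.
Qed.
#[export] Hint Resolve dec1_valid : tot.

Definition prov X x := exists L, valid X (dl L) /\ mem x L.

Lemma sig1_prov X : sig1 X (prov X).
Proof.
  unfold sig1, prov.
  apply (sig_ex X 1 (fun v L => valid X (dl L) /\ mem (nth 0 v 0) L)).
  apply sig_dec. apply dec_and; [|decs].
  apply (dec_comp1 X 2 (fun L => valid X (dl L))); decs.
Qed.
#[export] Hint Resolve sig1_prov : tot.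

(** The bounds in [just] survive the passage to another list because each bounded value occurs in a
    judgement of the list, and every entry lies below the code of the list. *)
Lemma just_mono X x l l' : incl l l' -> just X x (cl l) -> just X x (cl l').
Proof.
  intros Hi. unfold just, mem. rewrite !dl_cl.
  assert (HJ : forall e v y, In (J e v y) l -> v < cl l' /\ y < cl l').
  { intros e v y H. apply Hi, cl_In in H. destruct (J_ge e v y). lia. }
  intros [H|[H|[H|[H|[H|[H|[H|[H|[H|H]]]]]]]]];
    [left|right;left|do 2 right;left|do 3 right;left|do 4 right;left|do 5 right;left
    |do 6 right;left|do 7 right;left|do 8 right;left|do 9 right]; auto.
  - destruct H as [H [ws [_ [H1 H2]]]]. split; auto. exists ws.
    split; [apply (HJ _ _ _ H2)|]. auto.
  - intuition.
  - destruct H as [H [H0 [H1 [r [_ [H2 H3]]]]]]. repeat (split; auto). exists r.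
    split; [apply (HJ _ _ _ H2)|]. auto.
  - destruct H as [H [H0 H1]]. repeat (split; auto). intros m Hm.
    destruct (H1 m Hm) as [k [_ Hk]]. exists k. split; auto.
    apply HJ in Hk. lia.
  - intuition.
Qed.

Lemma valid_app X l l' : valid X l -> valid X l' -> valid X (l ++ l').
Proof.
  induction l as [|x l IH]; simpl; auto. intros [H1 H2] H'. split; auto.
  eapply just_mono; [|eassumption]. apply incl_appl, incl_refl.
Qed.

Lemma prov_list X (l : list nat) : (forall x, In x l -> prov X x) ->
  exists l', valid X l' /\ incl l l'.
Proof.
  induction l as [|x l IH]; intros H.
  - exists []. split; simpl; auto. apply incl_refl.
  - destruct IH as [l' [H1 H2]]; [intros; apply H; simpl; auto|].
    destruct (H x) as [L [H3 H4]]; [simpl; auto|].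
    exists (dl L ++ l'). split; [apply valid_app; auto|].
    intros z [<-|Hz]; apply in_or_app; auto.
Qed.

Lemma prov_just X x (l : list nat) :
  (forall x, In x l -> prov X x) -> just X x (cl l) -> prov X x.
Proof.
  intros H Hj. destruct (prov_list X l H) as [l' [H1 H2]].
  exists (cl (x :: l')). unfold mem. rewrite dl_cl. split; [|simpl; auto].
  simpl. split; auto. eapply just_mono; eauto.
Qed.

Ltac jcase :=
  unfold just; rewrite ?je_J, ?jv_J, ?jy_J, ?pi2_cpair, ?pi1_cpair;
  rewrite ?pi2_cpair, ?pi1_cpair;
  unfold lenc, nthc, mem; rewrite ?dl_cl, ?ctl_cl, ?chd_cl; simpl length; simpl nth; simpl tl.

Lemma eval_prov X c v y : eval X c v y -> prov X (J (enc c) (cl v) y).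
Proof.
  revert c v y.
  apply (eval_nested_ind X (fun c v y => prov X (J (enc c) (cl v) y))
    (fun gs v ws => prov X (J (cpair 7 (encl gs)) (cl v) (cl ws)))).
  - intros v. apply prov_just with []; [simpl; tauto|]. jcase. left. auto.
  - intros x v. apply prov_just with []; [simpl; tauto|]. jcase. right; left.
    repeat split; auto. lia.
  - intros i v Hi. apply prov_just with []; [simpl; tauto|]. cbn [enc]. jcase.
    do 2 right; left. auto.
  - intros x v. apply prov_just with []; [simpl; tauto|]. jcase. do 3 right; left.
    repeat split; auto. lia.
  - intros f gs v ws y IH1 IH2. rewrite enc_comp.
    apply prov_just with [J (cpair 7 (encl gs)) (cl v) (cl ws); J (enc f) (cl ws) y].
    + intros x [<-|[<-|[]]]; auto.
    + jcase. do 4 right; left. split; auto. exists (cl ws).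
      split; [|simpl; auto].
      eapply Nat.le_lt_trans; [|apply cl_In; right; left; reflexivity]. apply J_ge.
  - intros f g v y IH. cbn [enc].
    apply prov_just with [J (enc f) (cl v) y].
    + intros x [<-|[]]; auto.
    + jcase. do 5 right; left. repeat split; auto; try lia. left. reflexivity.
  - intros f g n v r y IH1 IH2. cbn [enc] in *.
    apply prov_just with [J (cpair 5 (cpair (enc f) (enc g))) (cl (n :: v)) r;
                          J (enc g) (cl (n :: r :: v)) y].
    + intros x [<-|[<-|[]]]; auto.
    + jcase. do 6 right; left. repeat split; auto; try lia. exists r.
      split; [|simpl; auto].
      eapply Nat.le_lt_trans; [|apply cl_In; left; reflexivity]. apply J_ge.
  - intros f v n IH1 IH2. cbn [enc].
    (* The number of premises of [e_mu] depends on [n]; they are gathered into one list by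
       induction. *)
    assert (forall N, N <= n -> exists l, (forall x, In x l -> prov X x) /\
      forall m, m < N -> exists k, In (J (enc f) (cl (m :: v)) (S k)) l) as H.
    { induction N as [|N IHN]; intros HN.
      - exists []. split; [simpl; tauto|]. intros; lia.
      - destruct IHN as [l [H1 H2]]; [lia|]. destruct (IH2 N) as [k Hk]; [lia|].
        exists (J (enc f) (cl (N :: v)) (S k) :: l). split.
        + intros x [<-|Hx]; auto.
        + intros m Hm. destruct (Nat.eq_dec m N) as [->|Hn].
          * exists k. left. reflexivity.
          * destruct (H2 m) as [k' Hk']; [lia|]. exists k'. right. auto. }
    destruct (H n (le_n n)) as [l [H1 H2]].
    apply prov_just with (J (enc f) (cl (n :: v)) 0 :: l).
    + intros x [<-|Hx]; auto.
    + jcase. do 7 right; left. repeat split; auto; [left; reflexivity|].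
      intros m Hm. destruct (H2 m Hm) as [k Hk]. exists k. split; [|right; exact Hk].
      assert (S k <= J (enc f) (cl (m :: v)) (S k)) by apply J_ge.
      assert (J (enc f) (cl (m :: v)) (S k) < cl (J (enc f) (cl (n :: v)) 0 :: l))
        by (apply cl_In; right; exact Hk). simpl cl in *. lia.
  - intros v. apply prov_just with []; [simpl; tauto|]. jcase. do 8 right; left. auto.
  - intros g gs v y ys IH1 IH2. cbn [encl].
    apply prov_just with [J (enc g) (cl v) y; J (cpair 7 (encl gs)) (cl v) (cl ys)].
    + intros x [<-|[<-|[]]]; auto.
    + jcase. do 9 right. cbn [cl] in *. unfold chd, ctl. cbn [pred].
      rewrite ?pi1_cpair, ?pi2_cpair. repeat split; auto; try lia; simpl; auto.
Qed.

(** Induction on the list works because the premises of an entry lie in its tail. Programs and lists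
    of programs are treated together, as their rules refer to each other. *)
Lemma valid_sound X l : valid X l ->
  (forall c v y, In (J (enc c) (cl v) y) l -> eval X c v y) /\
  (forall gs v ws, In (J (cpair 7 (encl gs)) (cl v) (cl ws)) l -> evals X gs v ws).
Proof.
  induction l as [|x l IH]; simpl; [tauto|]. intros [Hj Hv].
  destruct (IH Hv) as [IH1 IH2]. clear IH Hv. split.
  - intros c v y [->|H]; [|auto]. revert Hj.
    destruct c as [| |i| |f gs|f g|f]; rewrite ?enc_comp; cbn [enc]; jcase.
    all: intros [H|[H|[H|[H|[H|[H|[H|[H|[H|H]]]]]]]]].
    (* The tag in the code leaves only the rules for the given constructor. *)
    all: try (exfalso; destruct H as [H _]; try apply cpair_inj in H; lia).
    + destruct H as [_ ->]. constructor.
    + destruct H as [_ [H ->]]. destruct v; simpl in *; [lia|]. constructor.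
    + destruct H as [_ [H ->]]. constructor. exact H.
    + destruct H as [_ [H ->]]. destruct v; simpl in *; [lia|]. apply e_oracle.
    (* Here [ws] is merely a number; it has to be read as the code of a list. *)
    + destruct H as [_ [ws [_ [H1 H2]]]]. rewrite <- (cl_dl ws) in H1, H2.
      econstructor; eauto.
    + destruct H as [_ [H [H1 H2]]]. destruct v as [|n v]; simpl in *; [lia|].
      rewrite H1. constructor. auto.
    + destruct H as [_ [H [H1 [r [_ [H2 H3]]]]]].
      destruct v as [|[|n] v]; simpl in *; try lia.
      apply e_primS with r; [|apply IH1; exact H3].
      apply IH1. exact H2.
    + destruct H as [_ [H H1]]. constructor; [apply IH1; exact H|].
      intros m Hm. destruct (H1 m Hm) as [k [_ Hk]]. exists k. apply IH1. exact Hk.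
  - intros gs v ws [->|H]; [|auto]. revert Hj. jcase.
    intros [H|[H|[H|[H|[H|[H|[H|[H|[H|H]]]]]]]]].
    all: try (exfalso; destruct H as [H _]; try apply cpair_inj in H; lia).
    + destruct H as [_ [H1 H2]]. destruct gs; [|discriminate].
      destruct ws; [|discriminate]. constructor.
    + destruct H as [_ [H1 [H2 [H3 H4]]]].
      destruct gs as [|g gs]; [simpl in H1; lia|].
      destruct ws as [|w ws]; [simpl in H2; lia|].
      simpl in *. unfold chd, ctl in *. cbn [pred] in *.
      rewrite ?pi1_cpair, ?pi2_cpair in *. constructor; auto.
Qed.

Lemma eval_iff_prov X c v y : eval X c v y <-> prov X (J (enc c) (cl v) y).
Proof.
  split; [apply eval_prov|]. intros [L [HL Hm]].
  apply (valid_sound X (dl L) HL). exact Hm.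
Qed.

Lemma computable_iff_tot1 f : computable f <-> tot1 empty_oracle f.
Proof.
  split; intros [c Hc]; exists c.
  - intros [|x [|]] Hv; try discriminate. apply Hc.
  - intros x. apply (Hc [x]). reflexivity.
Qed.

Lemma sig1_ce A : sig1 empty_oracle A -> ce_set A.
Proof.
  intros H. apply sig_code in H as [c Hc]. exists c. intros y. apply (Hc [y]). reflexivity.
Qed.

Lemma sig2_Sigma01 X R : sig2 X R -> Sigma01 X R.
Proof.
  intros H. apply sig_code in H as [c Hc]. exists c. intros x y.
  apply (Hc [x; y]). reflexivity.
Qed.

(** * Deciding c.e. predicates from the halting set *)

Fixpoint constc (n : nat) : code :=
  match n with 0 => czero | S k => ccomp csucc [constc k] end.

Lemma eval_constc X n v y : eval X (constc n) v y <-> y = n.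
Proof.
  revert y. induction n as [|n IH]; intros y; simpl.
  - split; [intros H; inversion H; auto|intros ->; constructor].
  - split.
    + intros H. inversion H as [| | | |f gs v' ws y' H1 H2| | |]; subst.
      inversion H1 as [|g gs' v' y' ys H3 H4]; subst. inversion H4; subst.
      apply IH in H3. inversion H2; subst. reflexivity.
    + intros ->. econstructor; [|constructor].
      constructor; [apply IH; reflexivity|constructor].
Qed.

Lemma tot1_enc_constc X : tot1 X (fun n => enc (constc n)).
Proof.
  apply tot_ext with (fun v => nat_rect (fun _ => nat) (cpair 0 0) (fun _ r =>
    cpair 4 (cpair (cpair 1 0) (ccons r 0))) (nth 0 v 0)).
  - intros v _. induction (nth 0 v 0) as [|n IH]; [reflexivity|].
    cbn [constc]. rewrite enc_comp. simpl nat_rect. rewrite IH. reflexivity.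
  - tots.
Qed.

(* If [c] is a program for [P], then [P x] holds iff the program "run [c] on the constant
   [x]" halts on its own code. *)
Lemma sig1_dec1_jump X P :
  turing_below halting_set X -> sig1 empty_oracle P -> dec1 X P.
Proof.
  intros [d Hd] HP. apply sig_code in HP as [c Hc].
  set (s x := enc (ccomp c [constc x])).
  assert (tot1 X s) as Hs.
  { unfold s. pose proof (tot1_enc_constc X) as He.
    apply tot_ext with (fun v => cpair 4 (cpair (enc c)
      (ccons ((fun n => enc (constc n)) (nth 0 v 0)) 0))); [reflexivity|].
    tots. apply (tot_comp1 X 1 (fun n => enc (constc n))); tots. }
  assert (forall x, P x <-> halting_set (s x)) as H.
  { intros x. rewrite (Hc [x] eq_refl). split.
    - intros [z Hz]. exists (ccomp c [constc x]), z. split; auto.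
      econstructor; [|exact Hz]. constructor; [apply eval_constc; reflexivity|constructor].
    - intros [c' [z [E Hz]]]. exists z.
      (* By [eval_iff_prov] evaluation depends only on the code, so [c'] can be exchanged for the
         intended program. *)
      apply eval_iff_prov in Hz. rewrite E in Hz. apply eval_iff_prov in Hz.
      inversion Hz as [| | | |f gs v' ws y' H1 H2| | |]; subst.
      inversion H1 as [|g gs' v' y' ys H3 H4]; subst. inversion H4; subst.
      apply eval_constc in H3. subst. exact H2. }
  set (h n := if excluded_middle_informative (halting_set n) then 1 else 0).
  assert (tot1 X h) as Hh.
  { exists d. intros [|n [|]] Hv; try discriminate. unfold h. simpl.
    destruct (Hd n) as [H1 H2].
    destruct (excluded_middle_informative (halting_set n)); auto. }
  exists (fun v => 1 - h (s (nth 0 v 0))). split.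
  - tots.
  - intros v _. rewrite H. unfold h.
    destruct (excluded_middle_informative (halting_set (s (nth 0 v 0)))); simpl;
      split; auto; try tauto; discriminate.
Qed.

Lemma sig2_dec2_jump X P :
  turing_below halting_set X -> sig2 empty_oracle P -> dec2 X P.
Proof.
  intros HX HP.
  assert (dec1 X (fun z => P (pi1 z) (pi2 z))) as H.
  { apply sig1_dec1_jump; auto. unfold sig1. sigs. }
  apply dec_ext with (fun v => (fun z => P (pi1 z) (pi2 z)) (cpair (nth 0 v 0) (nth 1 v 0))).
  - intros v _. cbv beta. rewrite pi1_cpair, pi2_cpair. tauto.
  - apply (dec_comp1 X 2 (fun z => P (pi1 z) (pi2 z))); decs.
Qed.

Lemma sig3_dec3_jump X P :
  turing_below halting_set X -> sig3 empty_oracle P -> dec3 X P.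
Proof.
  intros HX HP.
  assert (dec2 X (fun z y => P (pi1 z) (pi2 z) y)) as H.
  { apply sig2_dec2_jump; auto. unfold sig2. sigs. }
  apply dec_ext with (fun v => (fun z y => P (pi1 z) (pi2 z) y)
    (cpair (nth 0 v 0) (nth 1 v 0)) (nth 2 v 0)).
  - intros v _. cbv beta. rewrite pi1_cpair, pi2_cpair. tauto.
  - apply (dec_comp2 X 3 (fun z y => P (pi1 z) (pi2 z) y)); decs.
Qed.

(** * A dark ceer *)

Definition merge m z := if z =? pi1 m then pi2 m else z.

Lemma tot2_merge X : tot2 X merge.
Proof.
  apply tot_ext with (fun v =>
    if excluded_middle_informative (nth 1 v 0 = pi1 (nth 0 v 0))
    then pi2 (nth 0 v 0) else nth 1 v 0).
  - intros v _. unfold merge.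
    destruct (excluded_middle_informative _); destruct (Nat.eqb_spec (nth 1 v 0) (pi1 (nth 0 v 0)));
      tauto.
  - apply tot_if; decs.
Qed.
#[export] Hint Resolve tot2_merge : tot.

(* [L] codes a list of merges, the most recent one first. *)
Definition lab (L x : nat) : nat := lrec x (fun m _ r => merge m r) (dl L).

Lemma tot2_lab X : tot2 X lab.
Proof.
  apply (tot_lrec X 2 (fun v => nth 0 v 0) (fun v => nth 1 v 0) (fun m _ r _ => merge m r)); tots.
Qed.
#[export] Hint Resolve tot2_lab : tot.

Section DarkCeer.
  (* [hit e y w]: [w] witnesses that [y] belongs to the [e]-th c.e. set. *)
  Variable hit : nat -> nat -> nat -> Prop.
  Hypothesis hit_dec : dec3 empty_oracle hit.

  (* Stage [s = ((e, k), (y, w))] tries to make the [e]-th c.e. set meet the class of [k]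
     by merging the class of [y] into it. *)
  Definition se s := pi1 (pi1 s).
  Definition sk s := pi2 (pi1 s).
  Definition sy s := pi1 (pi2 s).
  Definition sw s := pi2 (pi2 s).
  Definition hits s := hit (se s) (sy s) (sw s).

  (* The requirement [r = (e, k)] acts only if it is not yet satisfied, and removes a label
     greater than [2 * r]; so at most [N] labels up to [2 * N] are ever removed. *)
  Definition acts (s L : nat) : Prop :=
    hits s /\ 2 * pi1 s < lab L (sy s) /\
    ~ exists s', s' < s /\ (hits s' /\ se s' = se s /\ lab L (sy s') = lab L (sk s)).

  Lemma acts_dec : dec2 empty_oracle acts.
  Proof. unfold dec2, acts, hits, se, sk, sy, sw. decs. Qed.

  (* The default [0 = cpair 0 0] merges 0 into itself. *)
  Definition next_merge s L :=
    if excluded_middle_informative (acts s L)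
    then cpair (lab L (sy s)) (lab L (sk s)) else 0.

  Lemma tot2_next_merge : tot2 empty_oracle next_merge.
  Proof.
    apply (tot_if _ 2 (fun v => acts (nth 0 v 0) (nth 1 v 0))
      (fun v => cpair (lab (nth 1 v 0) (sy (nth 0 v 0))) (lab (nth 1 v 0) (sk (nth 0 v 0))))
      (fun _ => 0)).
    - exact acts_dec.
    - unfold sy, sk. tots.
    - tots.
  Qed.

  Definition hist s :=
    nat_rect (fun _ => nat) 0 (fun s L => ccons (next_merge s L) L) s.

  Lemma tot1_hist : tot1 empty_oracle hist.
  Proof. pose proof tot2_next_merge. unfold tot1, hist. tots. Qed.

  Definition labs s x := lab (hist s) x.
  Definition act s := acts s (hist s).

  Lemma labs_S s x : labs (S s) x = merge (next_merge s (hist s)) (labs s x).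
  Proof.
    unfold labs, lab. simpl hist. rewrite <- (cl_dl (hist s)) at 2.
    change (ccons ?a (cl ?l)) with (cl (a :: l)). rewrite dl_cl. reflexivity.
  Qed.

  Lemma labs_act s x : act s -> labs (S s) x =
    if labs s x =? labs s (sy s) then labs s (sk s) else labs s x.
  Proof.
    intros H. rewrite labs_S. unfold next_merge, act in *.
    destruct (excluded_middle_informative _); [|tauto].
    unfold merge. rewrite pi1_cpair, pi2_cpair. reflexivity.
  Qed.

  Lemma labs_idle s x : ~ act s -> labs (S s) x = labs s x.
  Proof.
    intros H. rewrite labs_S. unfold next_merge, act in *.
    destruct (excluded_middle_informative _); [tauto|].
    unfold merge. change (pi1 0) with 0. change (pi2 0) with 0.
    destruct (Nat.eqb_spec (labs s x) 0); congruence.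
  Qed.

  (** At an acting stage the label of [sk s] is at most [sk s], hence at most [pi1 s], while that of
      [sy s] exceeds [2 * pi1 s]. Each merge thus replaces a label by a smaller one, which keeps
      labels below their arguments and idempotent. *)
  Lemma labs_inv s : (forall x, labs s x <= x) /\ (forall x, labs s (labs s x) = labs s x) /\
    (act s -> labs s (sk s) < labs s (sy s)).
  Proof.
    assert (forall s, (forall x, labs s x <= x) -> act s -> labs s (sk s) < labs s (sy s)) as Hlt.
    { intros t Ht [_ [Hg _]]. specialize (Ht (sk t)). unfold sk in *. destruct (pi_le (pi1 t)).
      fold (labs t (sy t)) in Hg. lia. }
    induction s as [|s [IH1 [IH2 IH3]]].
    - assert (forall x, labs 0 x = x) as H by reflexivity.
      split; [intros; rewrite H; lia|]. split; [reflexivity|]. apply Hlt. intros; rewrite H; lia.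
    - assert (forall x, labs (S s) x <= x) as H1.
      { intros x. specialize (IH1 x). destruct (classic (act s)) as [Ha|Ha].
        - rewrite labs_act by assumption. specialize (IH3 Ha).
          destruct (Nat.eqb_spec (labs s x) (labs s (sy s))); lia.
        - rewrite labs_idle; auto. }
      split; [|split]; auto. intros x. destruct (classic (act s)) as [Ha|Ha].
      + specialize (IH3 Ha). rewrite (labs_act s x) by assumption.
        destruct (Nat.eqb_spec (labs s x) (labs s (sy s))) as [E|E].
        * rewrite labs_act, IH2 by assumption.
          destruct (Nat.eqb_spec (labs s (sk s)) (labs s (sy s))); lia.
        * rewrite labs_act, IH2 by assumption.
          destruct (Nat.eqb_spec (labs s x) (labs s (sy s))); congruence.
      + rewrite !labs_idle; auto.
  Qed.

  Lemma labs_pres s t x y : s <= t -> labs s x = labs s y -> labs t x = labs t y.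
  Proof.
    induction 1; auto. intros H'. rewrite !labs_S, IHle; auto.
  Qed.

  Lemma labs_merged s t : act s -> s < t -> labs t (sy s) = labs t (sk s).
  Proof.
    intros Ha Ht. apply (labs_pres (S s)); [exact Ht|].
    destruct (labs_inv s) as [_ [_ H]]. specialize (H Ha).
    rewrite !labs_act, Nat.eqb_refl by assumption.
    destruct (Nat.eqb_spec (labs s (sk s)) (labs s (sy s))); lia.
  Qed.

  (** After acting at [s], the classes of [sy s] and [sk s] stay merged, so [s] itself shows at
      every later stage that the requirement is satisfied. *)
  Lemma act_once s t : act s -> act t -> pi1 s = pi1 t -> s = t.
  Proof.
    assert (forall s t, act s -> act t -> pi1 s = pi1 t -> ~ s < t) as H.
    { clear. intros s t Hs [_ [_ Ht]] E Hl. apply Ht. exists s. split; auto.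
      split; [apply Hs|]. split; [unfold se; congruence|].
      pose proof (labs_merged s t Hs Hl) as Hm. unfold sk in *. rewrite <- E. exact Hm. }
    intros Hs Ht E. destruct (lt_eq_lt_dec s t) as [[Hl|He]|Hl]; auto; exfalso;
      [apply (H s t)|apply (H t s)]; auto.
  Qed.

  Definition ceer x y := exists s, labs s x = labs s y.

  Lemma ceer_equiv : is_equiv ceer.
  Proof.
    split; [|split].
    - intros x. exists 0. reflexivity.
    - intros x y [s H]. exists s. auto.
    - intros x y z [s H] [t H']. exists (s + t).
      transitivity (labs (s + t) y); [apply (labs_pres s)|apply (labs_pres t)]; auto; lia.
  Qed.

  Lemma sig2_ceer : sig2 empty_oracle ceer.
  Proof.
    pose proof tot1_hist. unfold sig2, ceer, labs. sigs.
  Qed.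

  Lemma ceer_roots N : exists x, N <= x /\ forall y, ceer x y -> x <= y.
  Proof.
    assert (exists x, N <= x /\ forall s, act s -> labs s (sy s) <> x) as [x [Hx Hr]].
    { apply NNPP. intros Hn.
      assert (forall x, exists s, N <= x -> act s /\ labs s (sy s) = x) as H.
      { intros x. destruct (classic (N <= x)) as [Hx|Hx]; [|exists 0; tauto].
        apply NNPP. intros H. apply Hn. exists x. split; auto. intros s Ha E.
        apply H. exists s. auto. }
      set (f x := proj1_sig (constructive_indefinite_description _ (H x))).
      assert (forall x, N <= x -> act (f x) /\ labs (f x) (sy (f x)) = x) as Hf.
      { intros x. exact (proj2_sig (constructive_indefinite_description _ (H x))). }
      (* Pigeonhole: if the [N + 2] labels from [N] to [2 * N + 1] were all removed, distinct
         requirements would have removed them. Each such requirement is at most [N], which leaves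
         only [N + 1] of them. *)
      assert (length (map (fun x => pi1 (f x)) (seq N (N + 2))) <= length (seq 0 (N + 1))) as Hl.
      { apply NoDup_incl_length.
        - apply NoDup_map_NoDup_ForallPairs; [|apply seq_NoDup].
          intros x y Hx Hy E. apply in_seq in Hx, Hy.
          destruct (Hf x) as [Ha Ea]; [lia|]. destruct (Hf y) as [Hb Eb]; [lia|].
          rewrite <- Ea, <- Eb, (act_once (f x) (f y)); auto.
        - intros z Hz. apply in_map_iff in Hz as [x [<- Hx]]. apply in_seq in Hx.
          destruct (Hf x) as [[_ [Ha _]] Ea]; [lia|]. unfold labs in Ea. rewrite Ea in Ha.
          apply in_seq. lia. }
      rewrite length_map, !length_seq in Hl. lia. }
    exists x. split; auto. intros y [s Hs].
    (* A label that is never removed remains its own label, and labels never exceed the numbers they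
       label. *)
    assert (labs s x = x) as E.
    { clear Hs. induction s as [|s IH]; [reflexivity|].
      destruct (classic (act s)) as [Ha|Ha].
      - rewrite labs_act, IH by assumption. specialize (Hr s Ha).
        destruct (Nat.eqb_spec x (labs s (sy s))); congruence.
      - rewrite labs_idle; auto. }
    rewrite <- E, Hs. apply labs_inv.
  Qed.

  (** Take [y] in the [e]-th set outside the classes of the numbers up to [2 * r]. Its label always
      exceeds [2 * r], so at the stage for [r], [y] and its witness either the requirement acts or
      it is already satisfied. *)
  Lemma ceer_dark e : (forall l, exists y w, hit e y w /\ forall z, In z l -> ~ ceer z y) ->
    forall k, exists y w, hit e y w /\ ceer y k.
  Proof.
    intros H k. set (r := cpair e k).
    destruct (H (seq 0 (S (2 * r)))) as [y [w [Hh Hn]]].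
    set (s := cpair r (cpair y w)).
    assert (se s = e /\ sk s = k /\ sy s = y /\ sw s = w /\ pi1 s = r) as [E1 [E2 [E3 [E4 E5]]]].
    { unfold se, sk, sy, sw, s, r. rewrite ?pi1_cpair, ?pi2_cpair, ?pi1_cpair, ?pi2_cpair. auto. }
    destruct (labs_inv s) as [_ [Hi _]].
    destruct (classic (act s)) as [Ha|Ha].
    - exists y, w. split; auto. exists (S s).
      pose proof (labs_merged s (S s) Ha (Nat.lt_succ_diag_r s)) as Hm.
      rewrite E2, E3 in Hm. exact Hm.
    - assert (exists s', s' < s /\ (hits s' /\ se s' = se s /\
        lab (hist s) (sy s') = lab (hist s) (sk s))) as [s' [_ [H1 [H2 H3]]]].
      { apply NNPP. intros Hs. apply Ha. split; [|split]; auto.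
        - unfold hits. rewrite E1, E3, E4. exact Hh.
        - rewrite E3, E5. apply Nat.nle_gt. intros Hle.
          apply (Hn (labs s y)).
          + apply in_seq. unfold labs. lia.
          + exists s. apply Hi. }
      exists (sy s'), (sw s'). unfold hits in H1. rewrite H2, E1 in H1. split; auto.
      exists s. rewrite E2 in H3. exact H3.
  Qed.
End DarkCeer.

Lemma dark_ceer : exists U, is_equiv U /\ sig2 empty_oracle U /\
  (forall N, exists x, N <= x /\ forall y, U x y -> x <= y) /\
  forall f, computable f ->
    (forall l, exists z, forall x, In x l -> ~ U x (f z)) ->
    forall k, exists z, U (f z) k.
Proof.
  (* The [e]-th c.e. set is taken to be the range of the program with code [e]. *)
  set (P e y := exists z, prov empty_oracle (J e (ccons z 0) y)).
  assert (sig2 empty_oracle P) as [F [HF HP]].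
  { unfold sig2, P. sigs. }
  set (hit e y w := F [w; e; y] = 0).
  assert (dec3 empty_oracle hit) as Hhit.
  { unfold dec3, hit. apply dec_eq; [|tots].
    apply (tot_comp _ 3 3 F [fun v => nth 2 v 0; fun v => nth 0 v 0; fun v => nth 1 v 0] HF);
      auto.
    repeat constructor; tots. }
  exists (ceer hit). repeat split; try apply ceer_equiv.
  - apply sig2_ceer, Hhit.
  - apply ceer_roots.
  - intros f [c Hc] Hinf k.
    assert (forall y, (exists w, hit (enc c) y w) <-> exists z, y = f z) as Hr.
    { intros y. specialize (HP [enc c; y] eq_refl). simpl in HP.
      unfold hit. rewrite <- HP. unfold P. split.
      - intros [z Hz]. exists z. apply (eval_iff_prov _ c [z]) in Hz.
        eapply eval_det; eauto.
      - intros [z ->]. exists z. apply (eval_iff_prov _ c [z]). auto. }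
    destruct (ceer_dark hit (enc c)) with (k := k) as [y [w [Hh Hy]]].
    + intros l. destruct (Hinf l) as [z Hz].
      destruct (proj2 (Hr (f z))) as [w Hw]; eauto.
    + destruct (proj1 (Hr y)) as [z ->]; eauto.
Qed.

(** * Coarsenings of a dark ceer *)

Lemma div2_iff q n : Nat.div2 n = q <-> n = 2 * q \/ n = S (2 * q).
Proof.
  split.
  - intros <-. pose proof (Nat.div2_odd n). destruct (Nat.odd n); simpl Nat.b2n in *; lia.
  - intros [->| ->]; [apply Nat.div2_double|apply Nat.div2_succ_double].
Qed.

Lemma tot1_div2 X : tot1 X Nat.div2.
Proof.
  apply tot_graph. apply dec_ext with
    (fun w => nth 1 w 0 = 2 * nth 0 w 0 \/ nth 1 w 0 = S (2 * nth 0 w 0)).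
  - intros [|q [|n [|]]] Hv; try discriminate. simpl nth. simpl tl.
    rewrite <- div2_iff. split; auto.
  - decs.
Qed.
#[export] Hint Resolve tot1_div2 : tot.

(* [iota] maps [x] to the number of least representatives below that of [x]. *)
Lemma index_exists X U : is_equiv U -> dec2 X U ->
  (forall N, exists x, N <= x /\ forall y, U x y -> x <= y) ->
  exists iota, tot1 X iota /\ (forall x y, U x y <-> iota x = iota y) /\
    forall n, exists x, iota x = n.
Proof.
  intros [Ur [Us Ut]] HU Hinf.
  set (root x := forall y, y < x -> ~ U x y).
  assert (dec1 X root) as Hrd by (unfold dec1, root; decs).
  assert (forall x y, root x -> root y -> U x y -> x = y) as Huniq.
  { intros x y Hx Hy H. destruct (lt_eq_lt_dec x y) as [[Hl|He]|Hl]; auto; exfalso.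
    - apply (Hy x Hl). auto.
    - apply (Hx y Hl). auto. }
  destruct (sig_select1 X (fun x r => U x r /\ root r)) as [rt [Hrt Hr]].
  { unfold sig2. sigs. }
  (* By descent, every number is related to the least element of its class. *)
  { induction x as [x IH] using lt_wf_ind.
    destruct (classic (root x)) as [Hx|Hx]; [eauto|].
    apply not_all_ex_not in Hx as [y Hy]. destruct (IH y) as [r [H1 H2]]; [tauto|].
    exists r. split; auto. apply Ut with y; auto. tauto. }
  set (cnt n := nat_rect (fun _ => nat) 0
    (fun k r => if excluded_middle_informative (root k) then S r else r) n).
  assert (forall n, cnt (S n) = if excluded_middle_informative (root n) then S (cnt n) else cnt n)
    as HS by reflexivity.
  assert (forall m n, m <= n -> cnt m <= cnt n) as Hmono.
  { induction 1; auto. rewrite HS. destruct (excluded_middle_informative (root m0)); lia. }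
  assert (forall m n, root m -> m < n -> cnt m < cnt n) as Hstrict.
  { intros m n Hm Hl. specialize (Hmono (S m) n Hl). rewrite HS in Hmono.
    destruct (excluded_middle_informative (root m)); [lia|tauto]. }
  assert (forall x y, U x y <-> rt x = rt y) as Hroot.
  { intros x y. destruct (Hr x) as [H1 H2], (Hr y) as [H3 H4]. split.
    - intros H. apply Huniq; auto. apply Ut with x; auto. apply Ut with y; auto.
    - intros E. apply Ut with (rt x); auto. rewrite E. auto. }
  exists (fun x => cnt (rt x)). split; [|split].
  - assert (tot1 X cnt); [|unfold tot1; tots].
    unfold tot1, cnt. apply (tot_rec X 1 (fun v => nth 0 v 0) (fun _ => 0)
      (fun k r _ => if excluded_middle_informative (root k) then S r else r)); tots.
    apply (tot_if X 3 (fun w => root (nth 0 w 0))); decs.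
  - intros x y. rewrite Hroot. split; [congruence|]. intros E.
    destruct (Hr x) as [_ H2], (Hr y) as [_ H4].
    destruct (lt_eq_lt_dec (rt x) (rt y)) as [[Hl|He]|Hl]; auto.
    + specialize (Hstrict _ _ H2 Hl). lia.
    + specialize (Hstrict _ _ H4 Hl). lia.
  - assert (forall n, exists r, root r /\ cnt r = n) as H.
    { induction n as [|n [r [Hrr Hc]]].
      - exists 0. split; [intros y Hy; lia|reflexivity].
      - destruct (Hinf (S r)) as [x [Hx Hxr]].
        assert (root x) as Hx' by (intros y Hy H; specialize (Hxr y H); lia).
        (* No root lies between [r] and the next root, so the count there is exactly one higher. *)
        assert (exists d, root (S r + d) /\ forall d', d' < d -> ~ root (S r + d')) as [d [Hd Hmin]].
        { clear Hxr. replace x with (S r + (x - S r)) in Hx' by lia.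
          revert Hx'. generalize (x - S r) as d. induction d as [d IH] using lt_wf_ind. intros Hd.
          destruct (classic (exists d', d' < d /\ root (S r + d'))) as [[d' [H1 H2]]|H].
          - apply (IH d' H1 H2).
          - exists d. split; auto. intros d' H1 H2. eauto. }
        exists (S r + d). split; auto.
        clear Hd. induction d as [|d IH].
        + rewrite Nat.add_0_r, HS.
          destruct (excluded_middle_informative (root r)); [lia|tauto].
        + rewrite Nat.add_succ_r, HS.
          destruct (excluded_middle_informative (root (S r + d))) as [Hd|Hd];
            [exfalso; apply (Hmin d); auto|]. apply IH. intros d' Hl. apply Hmin. lia. }
    intros n. destruct (H n) as [r [H1 H2]]. exists r.
    rewrite <- H2. f_equal. destruct (Hr r) as [H3 H4]. symmetry. apply Huniq; auto.
Qed.

(** Since [X] decides whether program [e] halts on [x], a search can stop with an arbitrary result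
    in case of divergence. This makes the universal function total, so that every reduction can be
    run [X]-effectively from its code. *)
Lemma apply_exists X : turing_below halting_set X ->
  exists psi, tot2 X psi /\
    forall c f x, (forall x, eval empty_oracle c [x] (f x)) -> psi (enc c) x = f x.
Proof.
  intros HX.
  set (Q e x y := prov empty_oracle (J e (ccons x 0) y)).
  assert (dec3 X Q) as HQ.
  { apply sig3_dec3_jump; auto. unfold sig3, Q. sigs. }
  assert (dec2 X (fun e x => exists y, Q e x y)) as HH.
  { apply sig2_dec2_jump; auto. unfold sig2, Q. sigs. }
  destruct (sig_select X 2 (fun v y =>
    Q (nth 0 v 0) (nth 1 v 0) y \/ ~ exists y, Q (nth 0 v 0) (nth 1 v 0) y)) as [h [Hh Hs]].
  - apply sig_dec. apply dec_or; [decs|]. apply dec_not.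
    apply (dec_comp2 X 3 (fun e x => exists y, Q e x y)); tots; auto.
  - intros v _. destruct (classic (exists y, Q (nth 0 v 0) (nth 1 v 0) y)) as [[y H]|H].
    + exists y. auto.
    + exists 0. auto.
  - exists (fun e x => h [e; x]). split.
    + apply (tot_comp X 2 2 h [fun v => nth 0 v 0; fun v => nth 1 v 0] Hh); auto.
      repeat constructor; tots.
    + intros c f x Hc. specialize (Hc x).
      assert (Q (enc c) x (f x)) as Hq by (apply (eval_iff_prov _ c [x]); exact Hc).
      destruct (Hs [enc c; x] eq_refl) as [H|H]; simpl in H.
      * apply (eval_iff_prov _ c [x]) in H. eapply eval_det; eauto.
      * exfalso. eauto.
Qed.

Section Coarsening.
  Variables (U : nat -> nat -> Prop) (iota : nat -> nat).
  Hypothesis U_sig : sig2 empty_oracle U.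
  Hypothesis U_dark : forall f, computable f ->
    (forall l, exists z, forall x, In x l -> ~ U x (f z)) ->
    forall k, exists z, U (f z) k.
  Hypothesis U_iota : forall x y, U x y <-> iota x = iota y.
  Hypothesis iota_onto : forall n, exists x, iota x = n.

  Definition paired (C : nat -> Prop) x y :=
    iota x = iota y \/ (Nat.div2 (iota x) = Nat.div2 (iota y) /\ C (Nat.div2 (iota x))).

  Lemma paired_equiv C : is_equiv (paired C).
  Proof.
    unfold paired. split; [|split].
    - auto.
    - intros x y [H|[H1 H2]]; [auto|]. right. rewrite <- H1. auto.
    - intros x y z [H|[H1 H2]] [H'|[H1' H2']].
      + left. congruence.
      + rewrite H. auto.
      + rewrite <- H'. auto.
      + right. split; congruence.
  Qed.

  Lemma paired_class C x : exists x0 x1, forall y, paired C x y <-> U x0 y \/ U x1 y.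
  Proof.
    unfold paired. destruct (classic (C (Nat.div2 (iota x)))) as [H|H].
    - destruct (iota_onto (2 * Nat.div2 (iota x))) as [x0 H0].
      destruct (iota_onto (S (2 * Nat.div2 (iota x)))) as [x1 H1].
      exists x0, x1. intros y. rewrite !U_iota, H0, H1.
      assert (iota y = 2 * Nat.div2 (iota x) \/ iota y = S (2 * Nat.div2 (iota x)) <->
        Nat.div2 (iota x) = Nat.div2 (iota y)) as E.
      { rewrite <- div2_iff. split; auto. }
      split.
      + intros [H2|[H2 _]]; [assert (Nat.div2 (iota x) = Nat.div2 (iota y)) by congruence|];
          intuition.
      + intros H2. right. intuition.
    (* Outside [C] the class is a single [U]-class, so the representative is repeated. *)
    - exists x, x. intros y. rewrite U_iota. tauto.
  Qed.

  Lemma paired_class_sig C x : sig1 empty_oracle (paired C x).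
  Proof.
    destruct (paired_class C x) as [x0 [x1 H]].
    apply sig_ext with (fun v => U x0 (nth 0 v 0) \/ U x1 (nth 0 v 0)).
    - intros v _. symmetry. apply H.
    - sigs.
  Qed.

  (** With one representative per class, the class of a number is found by enumerating all classes
      in parallel, which reduces [E] to [Id_ n]. Sending a residue to its representative gives the
      converse. *)
  Lemma finite_quotient E : is_equiv E -> (forall x, sig1 empty_oracle (E x)) ->
    (exists l, forall z, exists r, In r l /\ E r z) ->
    exists n, 1 <= n /\ cequiv E (Id_ n).
  Proof.
    intros [Er [Es Et]] Hsig [l Hl].
    assert (exists l, NoDup l /\ (forall a b, In a l -> In b l -> E a b -> a = b) /\
      forall z, exists r, In r l /\ E r z) as [l' [Hnd [Hinj Hcov]]].
    { enough (exists l', NoDup l' /\ (forall a b, In a l' -> In b l' -> E a b -> a = b) /\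
        forall z, (exists r, In r l /\ E r z) -> exists r, In r l' /\ E r z)
        as [l' [H1 [H2 H3]]] by (exists l'; auto).
      clear Hl. induction l as [|a l [l' [H1 [H2 H3]]]].
      - exists []. split; [constructor|]. split; simpl; [tauto|]. intros z [r [[] _]].
      - destruct (classic (exists r, In r l' /\ E r a)) as [[r [Hr Ha]]|Hn].
        + exists l'. split; auto. split; auto. intros z [r' [[<-|Hr'] Hz]]; eauto.
        + exists (a :: l'). split; [|split].
          * constructor; auto. intros Ha. apply Hn. eauto.
          * intros x y [<-|Hx] [<-|Hy] H; auto; exfalso; apply Hn; eauto.
          * intros z [r' [[<-|Hr'] Hz]]; [exists a; simpl; auto|].
            destruct (H3 z) as [r [Hr Hz']]; [eauto|]. exists r. simpl. auto. }
    clear l Hl. set (n := length l'). assert (0 < n) as Hn.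
    { destruct (Hcov 0) as [r [Hr _]]. unfold n. destruct l'; [destruct Hr|simpl; lia]. }
    assert (forall i j, i < n -> j < n -> E (nth i l' 0) (nth j l' 0) -> i = j) as Hidx.
    { intros i j Hi Hj H. apply (proj1 (NoDup_nth l' 0) Hnd i j Hi Hj).
      apply Hinj; auto; apply nth_In; auto. }
    (* Only finitely many classes are involved, so their enumerations, given without uniformity in
       the representative, combine into one. *)
    assert (sig2 empty_oracle (fun y r => In r l' /\ E r y)) as Hrep.
    { clear - Hsig. induction l' as [|a l' IH].
      - apply sig_ext with (fun _ => 0 = 1); [|sigs]. intros v _. simpl.
        split; [discriminate|tauto].
      - apply sig_ext with (fun v => (nth 1 v 0 = a /\ E a (nth 0 v 0)) \/
          (In (nth 1 v 0) l' /\ E (nth 1 v 0) (nth 0 v 0))).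
        + intros v _. simpl. split.
          * intros [[-> H]|H]; intuition.
          * intros [[<-|H] H']; auto.
        + apply sig_or; [|exact IH]. specialize (Hsig a).
          apply sig_and; [sigs|]. apply (sig_comp1 _ 2 (E a)); sigs. }
    destruct (sig_select1 empty_oracle (fun y i => exists r,
      (fun y r => In r l' /\ E r y) y r /\ (i < n /\ nthc i (cl l') = r))) as [h [Hh Hs]].
    { unfold sig2. apply (sig_ex _ 2 (fun v r => (fun y r => In r l' /\ E r y) (nth 0 v 0) r /\
        (nth 1 v 0 < n /\ nthc (nth 1 v 0) (cl l') = r))).
      apply sig_and; [|sigs].
      apply (sig_comp2 _ 3 (fun y r => In r l' /\ E r y)); auto; tots. }
    { intros y. destruct (Hcov y) as [r [Hr Hy]]. destruct (In_nth l' r 0 Hr) as [i [Hi E']].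
      exists i, r. unfold nthc. rewrite dl_cl. auto. }
    assert (forall y, h y < n /\ E (nth (h y) l' 0) y) as Hh'.
    { intros y. destruct (Hs y) as [r [[Hr Hy] [Hi Hn']]]. unfold nthc in Hn'.
      rewrite dl_cl in Hn'. rewrite Hn'. auto. }
    (* Residues are computed by search; the bound on the quotient makes the condition decidable. *)
    destruct (sig_select1 empty_oracle (fun x i => i < n /\
      exists q, q < S x /\ x = n * q + i)) as [m [Hm Hms]].
    { unfold sig2. sigs. }
    { intros x. exists (x mod n). split; [apply Nat.mod_upper_bound; lia|].
      exists (x / n). split; [|apply Nat.div_mod_eq].
      pose proof (Nat.Div0.div_le_upper_bound x n x). nia. }
    assert (forall x, m x = x mod n) as Hmod.
    { intros x. destruct (Hms x) as [H1 [q [_ H2]]]. apply Nat.mod_unique with q; auto. }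
    exists n. split; [exact Hn|]. split.
    - exists h. split; [apply computable_iff_tot1; exact Hh|]. intros x y.
      destruct (Hh' x) as [H1 H2], (Hh' y) as [H3 H4]. unfold Id_.
      rewrite !Nat.mod_small by assumption. split.
      + intros H. apply Hidx; auto. eauto.
      + intros E'. rewrite E' in H2. eauto.
    - exists (fun x => nthc (m x) (cl l')). split.
      + apply computable_iff_tot1. unfold tot1. tots.
      + intros x y. unfold Id_, nthc. rewrite dl_cl, <- !Hmod.
        destruct (Hms x) as [H1 _], (Hms y) as [H2 _]. split.
        * intros ->. auto.
        * auto.
  Qed.

  (* If [f] meets infinitely many classes then, [U] being c.e., searching for [z] with
     [U (f z) k] inverts the reduction [f]. *)
  Lemma paired_minimal C : minimal (paired C).
  Proof.
    split.
    - intros [l Hl].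
      assert (exists N, forall x, In x l -> iota x < N) as [N HN].
      { clear Hl. induction l as [|a l [N HN]].
        - exists 0. simpl. tauto.
        - exists (N + S (iota a)). intros x [<-|Hx]; [lia|]. specialize (HN x Hx). lia. }
      (* The pair of indices starting at [2 * N] lies beyond all the listed classes. *)
      destruct (iota_onto (2 * N)) as [x Hx]. destruct (Hl x) as [y [Hy Hxy]].
      specialize (HN y Hy). unfold paired in Hxy. rewrite Hx, Nat.div2_double in Hxy.
      destruct Hxy as [H|[H _]]; [lia|]. symmetry in H. apply div2_iff in H. lia.
    - intros E HE Hred. assert (creduc E (paired C)) as Hred' by exact Hred.
      destruct Hred as [f [Hf HfE]].
      destruct (paired_equiv C) as [Rr [Rs Rt]].
      assert (forall x y, U x y -> paired C x y) as HU.
      { intros x y H. left. apply U_iota. exact H. }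
      destruct (classic (forall l, exists z, forall x, In x l -> ~ U x (f z))) as [Hinf|Hfin].
      + left. split; auto.
        destruct (sig_select1 empty_oracle (fun k z => U (f z) k)) as [g [Hg Hgs]].
        * apply computable_iff_tot1 in Hf. unfold sig2. sigs.
        * apply U_dark; auto.
        * exists g. split; [apply computable_iff_tot1; exact Hg|]. intros x y.
          rewrite HfE. pose proof (HU _ _ (Hgs x)). pose proof (HU _ _ (Hgs y)).
          split; intros H'; eauto.
      + right. apply finite_quotient; auto.
        * intros x. apply computable_iff_tot1 in Hf.
          apply sig_ext with (fun v => paired C (f x) (f (nth 0 v 0))).
          -- intros v _. symmetry. apply HfE.
          -- pose proof (paired_class_sig C (f x)) as H.
             apply (sig_comp1 _ 1 (paired C (f x))); sigs.
        * apply not_all_ex_not in Hfin as [l Hl].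
          assert (forall z, exists x, In x l /\ U x (f z)) as Hl'.
          { intros z. apply NNPP. intros Hn. apply Hl. exists z. intros x Hx Hu.
            apply Hn. eauto. }
          enough (exists l', forall z, (exists x, In x l /\ U x (f z)) ->
            exists r, In r l' /\ E r z) as [l' H] by (exists l'; auto).
          clear Hl Hl'. induction l as [|a l [l' IH]].
          -- exists []. intros z [x [[] _]].
          (* Each listed [U]-class that meets the range of [f] is replaced by one preimage. *)
          -- destruct (classic (exists z, U a (f z))) as [[z Hz]|Hn].
             ++ exists (z :: l'). intros z' [x [[<-|Hx] Hu]].
                ** exists z. split; [left; auto|]. apply HfE. eauto.
                ** destruct (IH z') as [r [Hr Hr']]; [eauto|]. exists r. simpl. auto.
             ++ exists l'. intros z' [x [[<-|Hx] Hu]]; [exfalso|]; eauto.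
  Qed.
End Coarsening.

(** * Diagonalization *)

(** Exceeds the codes of all subsets of [[0, q)] listed in decreasing order. By monotonicity of
    pairing, the worst case puts every number in the list. *)
Fixpoint subset_bound (q : nat) : nat :=
  match q with 0 => 1 | S k => S (ccons k (subset_bound k)) end.

Lemma tot1_subset_bound X : tot1 X subset_bound.
Proof.
  apply tot_ext with (fun v =>
    nat_rect (fun _ => nat) 1 (fun k r => S (ccons k r)) (nth 0 v 0)).
  - intros v _. induction (nth 0 v 0) as [|k IH]; simpl; congruence.
  - tots.
Qed.
#[export] Hint Resolve tot1_subset_bound : tot.

Lemma subset_code (P : nat -> Prop) q :
  exists sg, sg < subset_bound q /\ forall m, mem m sg <-> m < q /\ P m.
Proof.
  enough (exists l, cl l < subset_bound q /\ forall m, In m l <-> m < q /\ P m)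
    as [l [H1 H2]] by (exists (cl l); unfold mem; rewrite dl_cl; auto).
  induction q as [|q [l [H1 H2]]].
  - exists []. simpl. split; [lia|]. intros m. lia.
  - destruct (classic (P q)) as [Hq|Hq].
    + exists (q :: l). split.
      * simpl. unfold ccons. pose proof (cpair_mono q (cl l) (subset_bound q)). lia.
      * intros m. simpl. rewrite H2. split; [intros [<-|H]; intuition lia|].
        intros [H H']. destruct (Nat.eq_dec q m); [auto|]. right. split; auto. lia.
    + exists l. split.
      * simpl. unfold ccons. destruct (cpair_ge q (subset_bound q)). lia.
      * intros m. rewrite H2. split; [intuition lia|]. intros [H H'].
        assert (m <> q) by congruence. split; auto. lia.
Qed.

Section Diagonal.
  Variables (X : nat -> bool) (iota : nat -> nat) (psi : nat -> nat -> nat) (xx : nat -> nat).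
  Hypothesis tot_iota : tot1 X iota.
  Hypothesis tot_psi : tot2 X psi.
  Hypothesis tot_xx : tot1 X xx.
  Hypothesis iota_xx : forall n, iota (xx n) = n.
  Hypothesis psi_enc : forall c f x,
    (forall x, eval empty_oracle c [x] (f x)) -> psi (enc c) x = f x.

  (* [xa n] and [xb n] represent the two classes that [paired iota C] merges iff [C n]. *)
  Definition xa n := xx (2 * n).
  Definition xb n := xx (S (2 * n)).

  Lemma tot1_xa : tot1 X xa.
  Proof. unfold tot1, xa. tots. Qed.
  Lemma tot1_xb : tot1 X xb.
  Proof. unfold tot1, xb. tots. Qed.
  Hint Resolve tot1_xa tot1_xb : tot.

  Definition ua e n := iota (psi e (xa n)).
  Definition ub e n := iota (psi e (xb n)).
  Lemma tot2_ua : tot2 X ua.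
  Proof. unfold tot2, ua. tots. Qed.
  Lemma tot2_ub : tot2 X ub.
  Proof. unfold tot2, ub. tots. Qed.
  Hint Resolve tot2_ua tot2_ub : tot.

  (* What [paired iota C] says about the images of [xa n] and [xb n] under the function with
     code [e], if [sg] codes [C] where it matters. *)
  Definition guess sg e n : Prop :=
    ua e n = ub e n \/ (Nat.div2 (ua e n) = Nat.div2 (ub e n) /\ mem (Nat.div2 (ua e n)) sg).

  Lemma dec3_guess : dec3 X guess.
  Proof. unfold dec3, guess. decs. Qed.
  Hint Resolve dec3_guess : tot.

  (** A sum serves as an upper bound for all its terms. Only the images of [xa] enter, because the
      membership question in [guess] is about [ua]. *)
  Definition usum e q t := nat_rect (fun _ => nat) 0 (fun sg r => r + ua e (q + sg)) t.

  Lemma tot3_usum : tot3 X usum.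
  Proof. unfold tot3, usum. tots. Qed.
  Hint Resolve tot3_usum : tot.

  Lemma usum_ge e q t sg : sg < t -> ua e (q + sg) <= usum e q t.
  Proof.
    unfold usum. induction t as [|t IH]; intros H; simpl; [lia|].
    destruct (Nat.eq_dec sg t) as [->|Hn]; [lia|]. specialize (IH ltac:(lia)). lia.
  Qed.

  (* Block [b = (i, e)] consists of the numbers [block b + sg] with [sg] below
     [subset_bound (block b)], one for each possible trace on [0, block b) of another set of
     the family, followed by the single number [block_end b]. The sum puts the next block
     beyond all class indices that the function [e] reaches from this block. *)
  Definition block b := nat_rect (fun _ => nat) 0
    (fun b q => S (q + subset_bound q + usum (pi2 b) q (subset_bound q))) b.
  Definition block_end b := block b + subset_bound (block b).

  Lemma tot1_block : tot1 X block.
  Proof. unfold tot1, block. tots. Qed.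
  Hint Resolve tot1_block : tot.
  Lemma tot1_block_end : tot1 X block_end.
  Proof. unfold tot1, block_end. tots. Qed.
  Hint Resolve tot1_block_end : tot.

  Lemma block_S b : block (S b) =
    S (block_end b + usum (pi2 b) (block b) (subset_bound (block b))).
  Proof. reflexivity. Qed.

  Lemma block_mono b b' : b < b' -> block_end b < block b'.
  Proof.
    induction 1; rewrite block_S; [lia|]. unfold block_end in *. lia.
  Qed.

  Lemma block_ge b : b <= block b.
  Proof. induction b; [lia|]. rewrite block_S. unfold block_end. lia. Qed.

  Lemma block_unique b b' n : block b <= n <= block_end b -> block b' <= n <= block_end b' ->
    b = b'.
  Proof.
    intros H H'. destruct (lt_eq_lt_dec b b') as [[Hl|He]|Hl]; auto;
      apply block_mono in Hl; lia.
  Qed.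

  (** As [paired iota C] relates [xa n] and [xb n] exactly when [C n] holds, running program [e] on
      this pair asks the [e]-th relation c.e. in [X] about [n]. *)
  Definition self_halts e n := exists z, prov X (J e (ccons (xa n) (ccons (xb n) 0)) z).

  Lemma sig2_self_halts : sig2 X self_halts.
  Proof. unfold sig2, self_halts. sigs. Qed.
  Hint Resolve sig2_self_halts : tot.

  Lemma self_halts_enc c n : self_halts (enc c) n <-> exists z, eval X c [xa n; xb n] z.
  Proof.
    unfold self_halts. change (ccons (xa n) (ccons (xb n) 0)) with (cl [xa n; xb n]).
    split; intros [z Hz]; exists z; apply eval_iff_prov; exact Hz.
  Qed.

  (* [G] rules the positions coding a trace, [D] the last position of the block. *)
  Definition in_block (D : nat -> nat -> Prop) (G : nat -> nat -> nat -> Prop) i n :=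
    exists b, b < S n /\ (pi1 b = i /\
      ((exists sg, sg < subset_bound (block b) /\ (n = block b + sg /\ G sg (pi2 b) n)) \/
       (n = block_end b /\ D (pi2 b) n))).

  (** Distinct blocks are disjoint, so only block [b] decides about this position. *)
  Lemma in_block_guess D G i b sg : pi1 b = i -> sg < subset_bound (block b) ->
    (in_block D G i (block b + sg) <-> G sg (pi2 b) (block b + sg)).
  Proof.
    intros Hi Hs. split.
    - intros [b' [_ [_ [[sg' [Hs' [E H]]]|[E H]]]]];
        assert (b = b') by (apply (block_unique b b' (block b + sg)); unfold block_end in *; lia);
        subst b'; [|unfold block_end in E; lia].
      replace sg with sg' by lia. replace (block b + sg') with (block b + sg) by lia. exact H.
    - intros H. exists b. split; [pose proof (block_ge b); lia|]. split; auto.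
      left. exists sg. auto.
  Qed.

  Lemma in_block_end D G i b : pi1 b = i ->
    (in_block D G i (block_end b) <-> D (pi2 b) (block_end b)).
  Proof.
    intros Hi. split.
    - intros [b' [_ [_ [[sg' [Hs' [E H]]]|[E H]]]]];
        assert (b = b') by (apply (block_unique b b' (block_end b)); unfold block_end in *; lia);
        subst b'; [unfold block_end in E; lia|exact H].
    - intros H. exists b. split; [pose proof (block_ge b); unfold block_end; lia|].
      split; auto.
  Qed.

  Lemma in_block_range D G i n : in_block D G i n ->
    exists b, pi1 b = i /\ block b <= n <= block_end b.
  Proof.
    intros [b [_ [Hi [[sg [Hs [E _]]]|[E _]]]]]; exists b; unfold block_end in *;
      split; auto; lia.
  Qed.

  Lemma sig1_in_block D G i : sig2 X D -> dec3 X G -> sig1 X (in_block D G i).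
  Proof.
    intros HD HG. unfold sig1, in_block. sigs.
  Qed.

  (** Inside the blocks of [i], complementation negates [D] and [G]; lying outside them is decidable
      in [X]. The complement thus has the same complexity as the negation of [D]. *)
  Lemma not_in_block D G i n : ~ in_block D G i n <->
    in_block (fun e n => ~ D e n) (fun sg e n => ~ G sg e n) i n \/
    ~ exists b, b < S n /\ (pi1 b = i /\ (block b <= n /\ n <= block_end b)).
  Proof.
    split.
    - intros H. destruct (classic (exists b, b < S n /\
        (pi1 b = i /\ (block b <= n /\ n <= block_end b)))) as [[b [Hb [Hi [H1 H2]]]]|Hn]; auto.
      left. destruct (Nat.eq_dec n (block_end b)) as [->|Hn].
      + rewrite in_block_end in * by assumption. exact H.
      + replace n with (block b + (n - block b)) in * by lia.
        assert (n - block b < subset_bound (block b)) by (unfold block_end in *; lia).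
        rewrite in_block_guess in * by (auto; lia). exact H.
    - intros [H1|H1] H.
      + destruct (in_block_range _ _ _ _ H) as [b [Hi Hr]].
        destruct (Nat.eq_dec n (block_end b)) as [->|Hn].
        * rewrite in_block_end in * by assumption. auto.
        * replace n with (block b + (n - block b)) in * by lia.
          assert (n - block b < subset_bound (block b)) by (unfold block_end in *; lia).
          rewrite in_block_guess in * by (auto; lia). auto.
      + destruct (in_block_range _ _ _ _ H) as [b [Hi Hr]]. apply H1. exists b.
        split; [pose proof (block_ge b); lia|]. split; auto.
  Qed.

  Lemma sig1_not_in_block D G i :
    sig2 X (fun e n => ~ D e n) -> dec3 X G -> sig1 X (fun n => ~ in_block D G i n).
  Proof.
    intros HD HG. eapply sig_ext; [intros v _; symmetry; apply not_in_block|].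
    apply sig_or; [|sigs].
    apply (sig1_in_block (fun e n => ~ D e n) (fun sg e n => ~ G sg e n)); auto.
    unfold dec3. decs.
  Qed.

  Lemma paired_xab C n : paired iota C (xa n) (xb n) <-> C n.
  Proof.
    unfold paired, xa, xb. rewrite !iota_xx, Nat.div2_double, Nat.div2_succ_double. split.
    - intros [H|[_ H]]; [lia|exact H].
    - auto.
  Qed.

  Definition diag D := in_block D (fun sg e n => ~ guess sg e n).

  (* In block [(i, e)] only the [i]-th set has elements, so at the position given by the true
     trace of the [j]-th set the guess is correct, and the [i]-th set contradicts it. *)
  Lemma diag_incomparable D i j : i <> j -> ~ creduc (paired iota (diag D i)) (paired iota (diag D j)).
  Proof.
    intros Hij [f [[c Hc] Hf]]. set (b := cpair i (enc c)).
    destruct (subset_code (diag D j) (block b)) as [sg [Hs Hm]].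
    set (n := block b + sg).
    assert (pi1 b = i /\ pi2 b = enc c) as [Hi He].
    { unfold b. rewrite pi1_cpair, pi2_cpair. auto. }
    assert (diag D i n <-> ~ guess sg (enc c) n) as H1.
    { unfold diag, n. rewrite in_block_guess by assumption. rewrite He. tauto. }
    specialize (Hf (xa n) (xb n)). rewrite paired_xab in Hf.
    (* The trace covers only numbers below block [b], but the [j]-th set has no others up to the
       queried one: block [b] belongs to [i], and all later blocks start beyond it. *)
    assert (diag D j (Nat.div2 (ua (enc c) n)) <-> mem (Nat.div2 (ua (enc c) n)) sg) as H2.
    { rewrite Hm. split; [|tauto]. intros H. split; auto. apply Nat.nle_gt. intros Hle.
      destruct (in_block_range _ _ _ _ H) as [b' [Hj Hr]].
      assert (b <> b') by congruence.
      assert (Nat.div2 (ua (enc c) n) < block (S b)) as Hlt.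
      { pose proof (Nat.div2_decr (ua (enc c) n) (ua (enc c) n) (Nat.le_succ_diag_r _)).
        pose proof (usum_ge (enc c) (block b) (subset_bound (block b)) sg Hs) as Hu.
        rewrite block_S, He. fold n in Hu. lia. }
      destruct (lt_eq_lt_dec b b') as [[Hl|]|Hl]; try tauto.
      - assert (block (S b) <= block b'); [|lia].
        destruct (Nat.eq_dec (S b) b') as [<-|]; [lia|].
        pose proof (block_mono (S b) b'). unfold block_end in *. lia.
      - apply block_mono in Hl. lia. }
    (* The reduction makes membership of [n] in the [i]-th set equivalent to the guess, while the
       construction makes it equivalent to the negation. *)
    unfold guess, paired in *. unfold ua, ub in *. rewrite !(psi_enc c f) in * by assumption.
    tauto.
  Qed.

  (** At the end of block [(i, enc c)] membership means that [c] halts there, so [c] cannot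
      semidecide the complement. The negated rule works in the same way against [c] semideciding the
      relation itself. *)
  Lemma diag_not_Pi01 i : ~ Pi01 X (paired iota (diag self_halts i)).
  Proof.
    intros [c Hc]. set (b := cpair i (enc c)).
    assert (pi1 b = i /\ pi2 b = enc c) as [Hi He].
    { unfold b. rewrite pi1_cpair, pi2_cpair. auto. }
    specialize (Hc (xa (block_end b)) (xb (block_end b))).
    rewrite paired_xab, <- self_halts_enc in Hc. unfold diag in Hc.
    rewrite in_block_end in Hc by assumption. rewrite He in Hc. tauto.
  Qed.

  Lemma diag_not_Sigma01 i : ~ Sigma01 X (paired iota (diag (fun e n => ~ self_halts e n) i)).
  Proof.
    intros [c Hc]. set (b := cpair i (enc c)).
    assert (pi1 b = i /\ pi2 b = enc c) as [Hi He].
    { unfold b. rewrite pi1_cpair, pi2_cpair. auto. }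
    specialize (Hc (xa (block_end b)) (xb (block_end b))).
    rewrite paired_xab, <- self_halts_enc in Hc. unfold diag in Hc.
    rewrite in_block_end in Hc by assumption. rewrite He in Hc. tauto.
  Qed.

  Lemma dec3_not_guess : dec3 X (fun sg e n => ~ guess sg e n).
  Proof. unfold dec3. decs. Qed.

  Lemma diag_Sigma01 i : Sigma01 X (paired iota (diag self_halts i)).
  Proof.
    apply sig2_Sigma01. pose proof dec3_not_guess.
    assert (sig1 X (diag self_halts i)) as HC by (apply sig1_in_block; auto with tot).
    revert HC. generalize (diag self_halts i) as C. intros C HC. unfold sig2, paired. sigs.
  Qed.

  Lemma diag_Pi01 i : Pi01 X (paired iota (diag (fun e n => ~ self_halts e n) i)).
  Proof.
    apply sig2_Sigma01. pose proof dec3_not_guess.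
    set (C := diag (fun e n => ~ self_halts e n) i).
    assert (sig1 X (fun n => ~ C n)).
    { apply sig1_not_in_block; auto.
      apply sig_ext with (fun v => self_halts (nth 0 v 0) (nth 1 v 0)); [|sigs].
      intros v _. split; [tauto|apply NNPP]. }
    apply sig_ext with (fun v => iota (nth 0 v 0) <> iota (nth 1 v 0) /\
      (Nat.div2 (iota (nth 0 v 0)) <> Nat.div2 (iota (nth 1 v 0)) \/
       (fun n => ~ C n) (Nat.div2 (iota (nth 0 v 0))))).
    - intros v _. unfold paired. tauto.
    - apply sig_and; [sigs|]. apply sig_or; [sigs|].
      apply (sig_comp1 X 2 (fun n => ~ C n)); sigs.
  Qed.
End Diagonal.

Theorem theorem1 (X : nat -> bool) (hX : turing_below halting_set X) :
  exists (E F : nat -> nat -> nat -> Prop),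
    (forall i, is_equiv (E i) /\ minimal (E i) /\
               Sigma01 X (E i) /\ ~ Pi01 X (E i)) /\
    (forall i j, i <> j -> ~ creduc (E i) (E j)) /\
    (forall i, is_equiv (F i) /\ minimal (F i) /\
               Pi01 X (F i) /\ ~ Sigma01 X (F i)) /\
    (forall i j, i <> j -> ~ creduc (F i) (F j)) /\
    (forall i x, ce_set (fun y => E i x y) /\ ce_set (fun y => F i x y)).
Proof.
  destruct dark_ceer as [U [HU [Usig [Uroots Udark]]]].
  destruct (index_exists X U HU (sig2_dec2_jump X U hX Usig) Uroots) as [iota [Hi [HUi Honto]]].
  destruct (apply_exists X hX) as [psi [Hpsi Hpsie]].
  destruct (sig_select1 X (fun n x => iota x = n)) as [xx [Hxx Hxi]]; auto.
  { unfold sig2. sigs. }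
  set (A D i := paired iota (diag iota psi xx D i)).
  exists (A (self_halts X xx)), (A (fun e n => ~ self_halts X xx e n)).
  (* These properties hold for coarsenings by arbitrary sets, so both families share them; only the
     complexity depends on [D]. *)
  assert (forall D i, is_equiv (A D i) /\ minimal (A D i) /\ forall x, ce_set (A D i x)) as HA.
  { intros D i. split; [apply paired_equiv|]. split; [eapply paired_minimal; eauto|].
    intros x. apply sig1_ce. eapply paired_class_sig; eauto. }
  split; [|split; [|split; [|split]]].
  - intros i. destruct (HA (self_halts X xx) i) as [H1 [H2 _]].
    split; auto. split; auto. split; [apply diag_Sigma01; auto|apply diag_not_Pi01; auto].
  - intros i j Hij. eapply diag_incomparable; eauto.
  - intros i. destruct (HA (fun e n => ~ self_halts X xx e n) i) as [H1 [H2 _]].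
    split; auto. split; auto. split; [apply diag_Pi01; auto|apply diag_not_Sigma01; auto].
  - intros i j Hij. eapply diag_incomparable; eauto.
  - intros i x. split; apply HA.
Qed.
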